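(* Let $J:=\operatorname{conv}\{\mathbf{v}_0,\mathbf{v}_1,\dots,\mathbf{v}_d\}\subset\mathbb{R}^d_{\ge0}\setminus\{\mathbf{0}\}$ be a $d$-simplex and let $f$ be $q$-homogeneous ($q\ge1$) and convex on $\operatorname{conv}(J\cup\{\mathbf{0}\})$. Then $$\operatorname{vol}(P^0(f,J))-\operatorname{vol}(P(f,J))=\frac{q-1}{(q+d+1)(d+2)}\int_J f(\mathbf{x})\,d\mathbf{x}.$$
   Context: $f$ is $q$-homogeneous if $f(\lambda\mathbf{x})=\lambda^q f(\mathbf{x})$ for all $\lambda\ge0$ (in particular $f(\mathbf{0})=0$). Let $\mu$ be the unique affine function agreeing with $f$ at the vertices of $J$ and $\mu(\mathbf{x},z):=z\mu(\mathbf{x}/z)$ (extended linearly in $(\mathbf{x},z)$). For $z\ge0$, $z\cdot J:=\{z\mathbf{x}:\mathbf{x}\in J\}$. Perspective relaxation: $P(f,J):=\operatorname{cl}\{(\mathbf{x},y,z):\mu(\mathbf{x},z)\ge y\ge zf(\mathbf{x}/z),\ \mathbf{x}\in z\cdot J,\ 1\ge z>0\}$. Naive relaxation: $P^0(f,J):=\{(\mathbf{x},y,z):\mu(\mathbf{x},z)\ge y\ge f(\mathbf{x}),\ \mathbf{x}\in z\cdot J,\ 1\ge z\ge0\}$, both in $\mathbb{R}^d\times\mathbb{R}\times\mathbb{R}$. $\operatorname{vol}$ is $(d+2)$-dimensional Lebesgue measure. *)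

(* Defs.v *)
From HB Require Import structures.
From mathcomp Require Import all_boot all_order all_algebra.
From mathcomp Require Import all_classical all_reals all_analysis.
Set Implicit Arguments. Unset Strict Implicit. Unset Printing Implicit Defensive.
Import Order.TTheory GRing.Theory Num.Theory.
Import numFieldTopology.Exports numFieldNormedType.Exports.
Local Open Scope classical_set_scope.
Local Open Scope ring_scope.

Definition box (R : realType) (n : nat) (a b : 'rV[R]_n) : set 'rV[R]_n :=
  [set x | forall i, a 0 i <= x 0 i <= b 0 i].
Definition boxvol (R : realType) (n : nat) (a b : 'rV[R]_n) : R :=
  \prod_(i < n) (b 0 i - a 0 i).

(* n-dimensional Lebesgue (outer) measure: infimum of the total volume of
   countable covers by boxes.  It coincides with Lebesgue measure on every
   Lebesgue measurable set (in particular on convex sets and their closures). *)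
Definition vol (R : realType) (n : nat) (A : set 'rV[R]_n) : \bar R :=
  ereal_inf [set S | exists a b : nat -> 'rV[R]_n,
    [/\ (forall k i, a k 0 i <= b k 0 i),
        A `<=` \bigcup_k box (a k) (b k) &
        S = (\sum_(0 <= k <oo) ((boxvol (a k) (b k))%:E))%E]].

Definition cvx_hull (R : realType) (n : nat) (S : set 'rV[R]_n) : set 'rV[R]_n :=
  [set x | exists (m : nat) (c : 'I_m -> R) (p : 'I_m -> 'rV[R]_n),
    [/\ (forall i, 0 <= c i), \sum_(i < m) c i = 1, (forall i, S (p i)) &
        x = \sum_(i < m) c i *: p i]].

Definition affinely_independent (R : realType) (n m : nat) (v : 'I_m -> 'rV[R]_n) :=
  forall c : 'I_m -> R, \sum_(i < m) c i *: v i = 0 -> \sum_(i < m) c i = 0 ->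
    forall i, c i = 0.

Definition homogeneous (R : realType) (n : nat) (q : R) (f : 'rV[R]_n -> R) :=
  forall (lam : R) x, 0 <= lam -> f (lam *: x) = lam `^ q * f x.

Definition convex_on (R : realType) (n : nat) (K : set 'rV[R]_n) (f : 'rV[R]_n -> R) :=
  forall x y (t : R), K x -> K y -> 0 <= t <= 1 ->
    f (t *: x + (1 - t) *: y) <= t * f x + (1 - t) * f y.

Definition scale_set (R : realType) (n : nat) (z : R) (J : set 'rV[R]_n) :=
  [set z *: x | x in J].

Definition affine_fun (R : realType) (d : nat) (a : 'rV[R]_d) (b : R) (x : 'rV[R]_d) : R :=
  \sum_(i < d) a 0 i * x 0 i + b.
Definition persp_affine (R : realType) (d : nat) (a : 'rV[R]_d) (b : R)
    (x : 'rV[R]_d) (z : R) : R :=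
  \sum_(i < d) a 0 i * x 0 i + b * z.

(* A point w of R^(d+2) is read as (x, y, z) with x in R^d. *)
Definition px (R : realType) (d : nat) (w : 'rV[R]_(d + 2)) : 'rV[R]_d := lsubmx w.
Definition py (R : realType) (d : nat) (w : 'rV[R]_(d + 2)) : R := rsubmx w 0 ord0.
Definition pz (R : realType) (d : nat) (w : 'rV[R]_(d + 2)) : R := rsubmx w 0 ord_max.

Definition Ppersp (R : realType) (d : nat) (f : 'rV[R]_d -> R) (J : set 'rV[R]_d)
    (a : 'rV[R]_d) (b : R) : set 'rV[R]_(d + 2) :=
  closure [set w | [/\ persp_affine a b (px w) (pz w) >= py w,
                       py w >= pz w * f ((pz w)^-1 *: px w),
                       scale_set (pz w) J (px w) & 0 < pz w <= 1]].

Definition Pnaive (R : realType) (d : nat) (f : 'rV[R]_d -> R) (J : set 'rV[R]_d)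
    (a : 'rV[R]_d) (b : R) : set 'rV[R]_(d + 2) :=
  [set w | [/\ persp_affine a b (px w) (pz w) >= py w,
               py w >= f (px w),
               scale_set (pz w) J (px w) & 0 <= pz w <= 1]].

(* Lebesgue integral of a real function over J, as the signed (d+1)-volume
   between its graph and the hyperplane t = 0. *)
Definition integral_over (R : realType) (d : nat) (J : set 'rV[R]_d)
    (f : 'rV[R]_d -> R) : \bar R :=
  (vol [set w : 'rV[R]_(d + 1) | J (lsubmx w) /\ (0 <= rsubmx w ord0 ord0 <= f (lsubmx w))%R]
   - vol [set w : 'rV[R]_(d + 1) | J (lsubmx w) /\ (f (lsubmx w) <= rsubmx w ord0 ord0 <= 0)%R])%E.

(* Main.v *)
Require Import Defs.
From HB Require Import structures.
From mathcomp Require Import all_boot all_order all_algebra.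
From mathcomp Require Import all_classical all_reals all_analysis.
From mathcomp Require Import measurable_realfun lra ring.
Set Implicit Arguments. Unset Strict Implicit. Unset Printing Implicit Defensive.
Import Order.TTheory GRing.Theory Num.Theory.
Import numFieldTopology.Exports numFieldNormedType.Exports.
Local Open Scope classical_set_scope.
Local Open Scope ring_scope.

(* For q > 1 the function f is nonnegative on J.  Let H be the region between 0
   and the graph of f over J.  Inside the cone {(x, y, z) : x in zJ, 0 <= y <=
   mu(x, z)} the complements of the naive and of the perspective relaxation are
   the "towers" {(zu, z^p t, z) : (u, t) in H, 0 < z <= 1} with p = q and p = 1.
   A tower T over H satisfies vol T = vol H / (p + d + 1): the part of T below
   height r is a diagonal image of T, so vol T (1 - r^(p+d+1)) is the volume of
   the part above r, and one lets r tend to 1.  Subtracting the two towers gives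
   the formula.  For q = 1 the two relaxations agree up to a null set.  All
   measurability comes from convexity: a bounded convex set with interior point
   c differs from its closure by a null set, since shrinking the closure towards
   c by any factor below 1 lands in the interior. *)

(** * Outer Lebesgue measure *)

Section BoxCovers.
Variable R : realType.
Implicit Types n : nat.

(** [vol] is only an outer measure, so volumes add up only along Caratheodory measurable sets, and
    measurability is derived from boxes and from convex sets with an interior point. The region
    between [f] and [mu] need not have interior: it is flat when [f] is affine on [J]. The affine
    ceiling is therefore replaced by a constant [M] that exceeds [mu] by at least 1 on [J]. The
    resulting convex bodies have interior and agree with the relaxations, up to null sets, once the
    closed condition [y <= mu] is imposed again. The volume law for towers is also not proved
    directly for [H]. An upper bound holds for all nonnegative sets and a lower bound for boxes
    cornered at the origin; measurability of [H] inside such a box then forces equality. *)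

Lemma boxvol_ge0 n (a b : 'rV[R]_n) : (forall i, a 0 i <= b 0 i) -> 0 <= boxvol a b.
Proof. by move=> ab; apply: prodr_ge0 => i _; rewrite subr_ge0. Qed.

Lemma lebesgue_measure_segment (a b : R) :
  a <= b -> lebesgue_measure (`[a, b]%classic : set R) = (b - a)%:E.
Proof.
rewrite lebesgue_measure_itv /= lte_fin; case: ltP => // ba ab.
by rewrite (_ : b = a) ?subrr //; apply/eqP; rewrite eq_le ba.
Qed.

(* Induction on the dimension: every slice of the cover covers the slice of the
   box, and integrating over the slicing coordinate gives the bound. *)
Lemma boxvol_le_cover n (a b : 'rV[R]_n) (D : pred nat) (A B : nat -> 'rV[R]_n) :
  (forall i, a 0 i <= b 0 i) -> (forall k i, A k 0 i <= B k 0 i) ->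
  box a b `<=` \bigcup_(k in [set k | D k]) box (A k) (B k) ->
  ((boxvol a b)%:E <= \sum_(0 <= k <oo) ((D k)%:R * boxvol (A k) (B k))%:E)%E.
Proof.
elim: n a b D A B => [|n IH] a b D A B ab AB cov.
  have [k /= Dk _] : (\bigcup_(k in [set k | D k]) box (A k) (B k)) 0.
    by apply: cov; case.
  have vol0 (x y : 'rV[R]_0) : boxvol x y = 1 by rewrite /boxvol big_ord0.
  have ge0 i : (0 <= ((D i)%:R * boxvol (A i) (B i))%:E)%E.
    by rewrite vol0 mulr1 lee_fin ler0n.
  apply: le_trans (nneseries_lim_ge k.+1 _) => //.
  rewrite big_nat_recr //= Dk !vol0 mulr1.
  by rewrite -[leLHS]add0e leeD2r // sume_ge0.
pose tl (x : 'rV[R]_n.+1) : 'rV[R]_n := \row_i x 0 (lift ord0 i).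
pose c := boxvol (tl a) (tl b); pose C k := boxvol (tl (A k)) (tl (B k)).
have volS (x y : 'rV[R]_n.+1) :
    boxvol x y = (y 0 ord0 - x 0 ord0) * boxvol (tl x) (tl y).
  rewrite /boxvol big_ord_recl; congr (_ * _).
  by apply: eq_bigr => i _; rewrite !mxE.
have C0 k : 0 <= C k by apply: boxvol_ge0 => i; rewrite !mxE.
have c0 : 0 <= c by apply: boxvol_ge0 => i; rewrite !mxE.
pose I : set R := `[a 0 ord0, b 0 ord0]%classic.
pose J k : set R := `[A k 0 ord0, B k 0 ord0]%classic.
pose g k t : \bar R := (((D k)%:R * C k)%:E * (\1_(J k) t)%:E)%E.
have mI : measurable I by exact: measurable_itv.
have mJ k : measurable (J k) by exact: measurable_itv.
pose h k : R -> \bar R := fun t => (\1_(J k) t)%:E.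
have m1 k : measurable_fun I (h k).
  by apply/measurable_EFinP; apply: measurable_funTS; exact: measurable_indic.
have mg k : measurable_fun I (g k) by apply: measurable_funeM; exact: m1.
have g0 k t : (0 <= g k t)%E by rewrite mule_ge0 // lee_fin ?mulr_ge0.
have slice t : I t -> (c%:E <= \sum_(0 <= k <oo) g k t)%E.
  rewrite /I /= in_itv /= => tI.
  (* Boxes that miss height [t] are dropped through a predicate, not replaced by degenerate boxes:
     the recursion ends in dimension 0, where every box has volume 1. *)
  pose Dt := [pred k | D k && (A k 0 ord0 <= t <= B k 0 ord0)].
  have := IH (tl a) (tl b) Dt (tl \o A) (tl \o B).
  have -> : (\sum_(0 <= k <oo) ((Dt k)%:R * boxvol ((tl \o A) k) ((tl \o B) k))%:E
          = \sum_(0 <= k <oo) g k t)%E.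
    apply: eq_eseriesr => k _; rewrite /g /= indicE /J -EFinM; congr EFin.
    by rewrite mem_setE in_itv /= -mulnb natrM -!mulrA [_ * C k]mulrC.
  apply => [i|k i|x xab]; rewrite ?mxE //.
  pose x' : 'rV[R]_n.+1 := \row_j (if unlift ord0 j is Some i then x 0 i else t).
  have [|k /= Dk xk] := cov x'.
    move=> j; rewrite mxE; case: unliftP => [i|] -> //.
    by have := xab i; rewrite !mxE.
  exists k => /=; last first.
    by move=> i; have := xk (lift ord0 i); rewrite !mxE liftK.
  by have := xk ord0; rewrite mxE unlift_none Dk.
have -> : ((boxvol a b)%:E = \int[lebesgue_measure]_(t in I) c%:E)%E.
  by rewrite integral_cst //= /I lebesgue_measure_segment // volS mulrC EFinM.
apply: le_trans.
  apply: (@ge0_le_integral _ _ _ lebesgue_measure I mI _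
    (fun t => \sum_(0 <= k <oo) g k t)%E) => //.
  by apply: ge0_emeasurable_sum => //; move=> k _; exact: mg.
rewrite integral_nneseries //; apply: lee_nneseries => k _.
  by move=> _; apply: integral_ge0.
rewrite /g ge0_integralZl_EFin ?mulr_ge0 //; last exact: m1.
rewrite integral_indic //; last exact: mJ.
rewrite volS mulrCA [leRHS]EFinM -[leRHS]muleC.
rewrite lee_wpmul2l ?lee_fin ?mulr_ge0 //.
rewrite -(lebesgue_measure_segment (AB k ord0)) le_measure ?inE //.
by apply: measurableI; [exact: mJ|exact: mI].
Qed.

End BoxCovers.

(** * The outer measure axioms for [vol] *)

Section VolOuterMeasure.
Variables (R : realType) (n : nat).
Implicit Types A B X : set 'rV[R]_n.

Lemma vol_ge0 A : (0 <= vol A)%E.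
Proof.
apply: le_ereal_inf_tmp => _ [a [b [ab _ ->]]]; apply: nneseries_ge0 => k _ _.
by rewrite lee_fin boxvol_ge0.
Qed.

Lemma le_vol A B : A `<=` B -> (vol A <= vol B)%E.
Proof.
move=> AB; apply: le_ereal_inf_tmp => _ [a [b [ab cov ->]]].
by apply: ereal_inf_lbound; exists a, b; split => //; exact: subset_trans cov.
Qed.

Lemma vol_le_cover A (a b : nat -> 'rV[R]_n) :
  (forall k i, a k 0 i <= b k 0 i) -> A `<=` \bigcup_k box (a k) (b k) ->
  (vol A <= \sum_(0 <= k <oo) (boxvol (a k) (b k))%:E)%E.
Proof. by move=> ab cov; apply: ereal_inf_lbound; exists a, b. Qed.

Lemma vol_sigma_subadditive : sigma_subadditive (@vol R n).
Proof.
move=> A; have [[i Aioo]|Afin] := pselect (exists i, vol (A i) = +oo%E).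
  rewrite (eseries_pinfty _ _ Aioo) ?leey // => k _.
  by rewrite -ltNye (lt_le_trans _ (vol_ge0 _)).
apply/lee_addgt0Pr => e e0.
apply: le_trans (epsilon_trick xpredT (fun i => vol_ge0 (A i)) (ltW e0)).
have /choice [G covG] i : exists ab : (nat -> 'rV[R]_n) * (nat -> 'rV[R]_n),
    [/\ (forall k j, ab.1 k 0 j <= ab.2 k 0 j),
       A i `<=` \bigcup_k box (ab.1 k) (ab.2 k) &
       (\sum_(0 <= k <oo) (boxvol (ab.1 k) (ab.2 k))%:E
          <= vol (A i) + (e / (2 ^ i.+1)%:R)%:E)%E].
  have ei0 : 0 < e / (2 ^ i.+1)%:R by rewrite divr_gt0 // ltr0n expn_gt0.
  have fini : vol (A i) \is a fin_num.
    by rewrite ge0_fin_numE ?vol_ge0 // ltey; apply/eqP => H; apply: Afin; exists i.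
  have [_ [a [b [ab cov ->]]] /ltW le] := lb_ereal_inf_adherent ei0 fini.
  by exists (a, b).
pose u i k := (boxvol ((G i).1 k) ((G i).2 k))%:E : \bar R.
have u0 i k : (0 <= u i k)%E.
  by rewrite lee_fin boxvol_ge0 // => j; have [+ _ _] := covG i; apply.
have /card_esym/ppcard_eqP[h] := card_nat2.
have hbij := @bij _ _ _ _ h.
apply: (@le_trans _ _ (\sum_(0 <= m <oo) u (h m).1 (h m).2)%E).
  apply: vol_le_cover => [m j|x [i _ Aix]].
    by have [+ _ _] := covG (h m).1; apply.
  have [_ /(_ x Aix) [k _ xk] _] := covG i.
  have [_ _ /(_ (i, k) I)[m _ hm]] := hbij.
  by exists m => //; rewrite hm.
rewrite nneseries_esumT // -(reindex_esum _ _ _ (fun m => u m.1 m.2) hbij).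
rewrite (_ : [set: nat * nat] = [set: nat] `*`` (fun=> [set: nat])); last first.
  by apply/seteqP; split.
rewrite -(@esum_esum R _ _ setT (fun=> setT) u) //.
rewrite -nneseries_esumT; last by move=> i; exact: esum_ge0.
apply: lee_nneseries => i _; first by move=> _; exact: esum_ge0.
by rewrite -nneseries_esumT //; have [_ _] := covG i.
Qed.

Hypothesis n_gt0 : (0 < n)%N.

Lemma boxvol_degenerate (a : 'rV[R]_n) : boxvol a a = 0.
Proof. by rewrite /boxvol (bigD1 (Ordinal n_gt0)) //= subrr mul0r. Qed.

Lemma vol_le_boxvol A (a b : 'rV[R]_n) :
  (forall i, a 0 i <= b 0 i) -> A `<=` box a b -> (vol A <= (boxvol a b)%:E)%E.
Proof.
(* Covers are infinite sequences, so the single box is padded with copies of the degenerate box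
   [[a, a]], which has volume 0 because [n > 0]. *)
move=> ab Aab; pose b' k : 'rV[R]_n := if k is 0%N then b else a.
apply: (le_trans (@vol_le_cover A (fun=> a) b' _ _)) => [[|k] i //|x Ax|].
  by exists 0%N => //; exact: Aab.
rewrite nneseries_recl //; last first.
  by case=> [|k] _; rewrite lee_fin; apply: boxvol_ge0 => i /=.
rewrite eseries_cond eseries0 ?adde0 // => -[|k]//= _ _.
by rewrite boxvol_degenerate.
Qed.

Lemma vol0 : vol (set0 : set 'rV[R]_n) = 0%E.
Proof.
apply/eqP; rewrite eq_le vol_ge0 andbT.
by rewrite (le_trans (@vol_le_boxvol set0 0 0 _ _)) // boxvol_degenerate.
Qed.

End VolOuterMeasure.

(* In dimension 0 every box has volume 1, hence [vol set0] is infinite. *)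
Definition outer_vol (R : realType) (n : nat) (n_gt0 : (0 < n)%N) :
  set 'rV[R]_n -> \bar R := @vol R n.

HB.instance Definition _ (R : realType) (n : nat) (n_gt0 : (0 < n)%N) :=
  isOuterMeasure.Build R 'rV[R]_n (@outer_vol R n n_gt0)
    (@vol0 R n n_gt0) (@vol_ge0 R n) (@le_vol R n) (@vol_sigma_subadditive R n).

Notation vol_measurable := (caratheodory_measurable (@vol _ _)).

(** * Measurable sets, volume of boxes, diagonal maps *)

Section VolMeasurable.
Variables (R : realType) (n : nat).
Hypothesis n_gt0 : (0 < n)%N.
Implicit Types A B X : set 'rV[R]_n.
Let mu : {outer_measure set 'rV[R]_n -> \bar R} := @outer_vol R n n_gt0.

Lemma volU_le A B : (vol (A `|` B) <= vol A + vol B)%E.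
Proof. exact: (outer_measureU2 mu). Qed.

Lemma vol_null_measurable A : vol A = 0%E -> vol_measurable A.
Proof.
move=> A0; apply: (le_caratheodory_measurable (mu := mu)) => X.
rewrite [X in (X + _)%E](_ : _ = 0%E) ?add0e; last first.
  by apply/eqP; rewrite eq_le vol_ge0 andbT -A0; apply: le_vol; exact: subIsetr.
by apply: le_vol; exact: subIsetl.
Qed.

Lemma vol_measurableD A B : vol_measurable A -> vol_measurable B ->
  vol_measurable (A `\` B).
Proof. exact: (caratheodory_measurable_setD (mu := mu)). Qed.

Lemma vol_measurableU A B : vol_measurable A -> vol_measurable B ->
  vol_measurable (A `|` B).
Proof. exact: (caratheodory_measurable_setU (mu := mu)). Qed.

Lemma vol_measurable_bigcup (F : (set 'rV[R]_n)^nat) :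
  (forall k, vol_measurable (F k)) -> vol_measurable (\bigcup_k F k).
Proof. exact: (caratheodory_measurable_bigcup (mu := mu)). Qed.

(* A covering box [a, b] is cut at the height of [r], clamped to [a, b]. *)
Lemma halfspace_measurable (j : 'I_n) (r : R) (H : set 'rV[R]_n) :
  (forall x : 'rV_n, x 0 j < r -> H x) -> (forall x, H x -> x 0 j <= r) ->
  vol_measurable H.
Proof.
move=> Hlt Hle; apply: (le_caratheodory_measurable (mu := mu)) => X.
apply: le_ereal_inf_tmp => _ [a [b [ab cov ->]]].
pose m k := Num.max (a k 0 j) (Num.min (b k 0 j) r).
pose b' k : 'rV[R]_n := \row_i (if i == j then m k else b k 0 i).
pose a' k : 'rV[R]_n := \row_i (if i == j then m k else a k 0 i).
have am k : a k 0 j <= m k by rewrite le_max lexx.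
have mb k : m k <= b k 0 j by rewrite ge_max ab ge_min lexx.
have ab' k i : a k 0 i <= b' k 0 i by rewrite mxE; case: eqP => // ->.
have a'b k i : a' k 0 i <= b k 0 i by rewrite mxE; case: eqP => // ->.
apply: (@le_trans _ _ (\sum_(0 <= k <oo) (boxvol (a k) (b' k))%:E
                     + \sum_(0 <= k <oo) (boxvol (a' k) (b k))%:E)%E).
  apply: leeD; apply: vol_le_cover => // x [/cov[k _ xk] Hx]; exists k => // i;
    rewrite mxE; case: eqP => // ->; have /andP[ax xb] := xk j.
  - by rewrite ax /= le_max le_min xb Hle // orbT.
  - rewrite xb andbT ge_max ax ge_min orbC leNgt; apply/orP; left.
    by apply/negP => /Hlt.
rewrite -nneseriesD => [|k _ _|k _ _]; rewrite ?lee_fin ?boxvol_ge0 //.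
apply: lee_nneseries => k _; first by rewrite adde_ge0 // lee_fin boxvol_ge0.
have volE (x y : 'rV[R]_n) :
    boxvol x y = (y 0 j - x 0 j) * \prod_(i < n | i != j) (y 0 i - x 0 i).
  by rewrite /boxvol (bigD1 j).
rewrite -EFinD lee_fin !volE !mxE eqxx.
have -> : \prod_(i < n | i != j) (b' k 0 i - a k 0 i)
        = \prod_(i < n | i != j) (b k 0 i - a k 0 i).
  by apply: eq_bigr => i /negbTE ij; rewrite mxE ij.
have -> : \prod_(i < n | i != j) (b k 0 i - a' k 0 i)
        = \prod_(i < n | i != j) (b k 0 i - a k 0 i).
  by apply: eq_bigr => i /negbTE ij; rewrite mxE ij.
by rewrite -mulrDl addrC subrKA.
Qed.

Lemma box_measurable (a b : 'rV[R]_n) : vol_measurable (box a b).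
Proof.
have -> : box a b = ~` \big[setU/set0]_(i < n)
    ([set x | x 0 i < a 0 i] `|` ~` [set x | x 0 i <= b 0 i]).
  apply/seteqP; split => [x xab|x nx i].
    rewrite -bigcup_seq => -[i _ [/=|/=]]; have /andP[xa xb] := xab i.
      by rewrite ltNge xa.
    by rewrite xb.
  apply/andP; split; rewrite leNgt; apply/negP => lt; apply: nx;
    rewrite -bigcup_seq; exists i => /=; rewrite ?mem_index_enum //; [by left|right].
  by rewrite leNgt lt.
apply: (caratheodory_measurable_setC (mu := mu)).
elim/big_ind : _ => [|A B mA mB|i _].
- exact: (caratheodory_measurable_set0 mu).
- exact: vol_measurableU.
- apply: vol_measurableU.
    by apply: (@halfspace_measurable i (a 0 i)) => x //= /ltW.
  apply: (caratheodory_measurable_setC (mu := mu)).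
  by apply: (@halfspace_measurable i (b 0 i)) => x //= /ltW.
Qed.

Lemma vol_box (a b : 'rV[R]_n) :
  (forall i, a 0 i <= b 0 i) -> vol (box a b) = (boxvol a b)%:E.
Proof.
move=> ab; apply/eqP; rewrite eq_le vol_le_boxvol //=.
apply: le_ereal_inf_tmp => _ [A [B [AB cov ->]]].
have := @boxvol_le_cover R n a b xpredT A B ab AB.
rewrite (@eq_eseriesr _ _ (fun k => (boxvol (A k) (B k))%:E)) => [|k _]; last first.
  by rewrite mul1r.
apply.
by move=> x /cov[k _ xk]; exists k.
Qed.

(** Maps of this form with positive [c] send boxes to boxes, so their effect on [vol] is read off
    from covers. Both the shrinking of convex sets and the scaling of towers are of this form. *)
Definition diag_affine (c t x : 'rV[R]_n) : 'rV[R]_n :=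
  \row_i (c 0 i * x 0 i + t 0 i).

Lemma vol_diag_affine_le A (c t : 'rV[R]_n) : (forall i, 0 < c 0 i) ->
  (vol (diag_affine c t @` A)
     <= (\prod_i c 0 i)%R%:E * vol A)%E.
Proof.
move=> c0; have P0 : 0 < \prod_i c 0 i by exact: prodr_gt0.
pose T := diag_affine c t.
rewrite -lee_pdivrMl //; apply: le_ereal_inf_tmp => _ [a [b [ab cov ->]]].
rewrite lee_pdivrMl //.
apply: (@le_trans _ _ (\sum_(0 <= k <oo) (boxvol (T (a k)) (T (b k)))%:E)%E).
  apply: vol_le_cover => [k i|_ [x /cov[k _ xk] <-]].
    by rewrite !mxE lerD2r ler_pM2l.
  by exists k => // i; rewrite !mxE !lerD2r !ler_pM2l.
rewrite -nneseriesZl => [|k _]; last by rewrite lee_fin boxvol_ge0.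
apply: lee_nneseries => k _; first by rewrite lee_fin boxvol_ge0 // => i; rewrite !mxE lerD2r ler_pM2l.
rewrite -EFinM lee_fin /boxvol -big_split /= le_eqVlt; apply/orP; left.
by apply/eqP/eq_bigr => i _; rewrite !mxE; ring.
Qed.

(** The reverse inequality is the upper bound applied to the inverse map, which is again diagonal
    affine. *)
Lemma vol_diag_affine A (c t : 'rV[R]_n) : (forall i, 0 < c 0 i) ->
  vol (diag_affine c t @` A)
    = ((\prod_i c 0 i)%R%:E * vol A)%E.
Proof.
move=> c0; apply/eqP; rewrite eq_le vol_diag_affine_le //=.
have P0 : 0 < \prod_i c 0 i by exact: prodr_gt0.
rewrite -lee_pdivlMl //.
pose c' : 'rV[R]_n := \row_i (c 0 i)^-1.
pose t' : 'rV[R]_n := \row_i - ((c 0 i)^-1 * t 0 i).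
have -> : (\prod_i c 0 i)^-1 = \prod_i c' 0 i.
  by rewrite -prodfV; apply: eq_bigr => i _; rewrite mxE.
apply: le_trans (vol_diag_affine_le _ t' _); last by move=> i; rewrite mxE invr_gt0.
apply: le_vol => x Ax; exists (diag_affine c t x); first by exists x.
apply/rowP => i; rewrite !mxE mulrDr mulrA mulVf ?lt0r_neq0 // mul1r.
by rewrite addrK.
Qed.

End VolMeasurable.

(** * Convex bodies *)

Section ConvexBodies.
Variable R : realType.

(** Scaling estimates are available only for factors [r < 1]; this is the passage to the limit from
    the left. *)
Lemma le_at1 (F G : R -> R) : {for 1, continuous F} -> {for 1, continuous G} ->
  (forall r, 0 < r < 1 -> F r <= G r) -> F 1 <= G 1.
Proof.
move=> cF cG FG; apply: (@ler_cvg_to _ (at_left (1 : R)) _ _ F G).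
- exact: cvg_at_left_filter.
- exact: cvg_at_left_filter.
- near=> r; apply: FG; apply/andP; split; near: r.
    exact: nbhs_left_gt.
  exact: nbhs_left_lt.
Unshelve. all: by end_near. Qed.

Variable n : nat.
Hypothesis n_gt0 : (0 < n)%N.
Implicit Types X : set 'rV[R]_n.

Definition cvx_set X := forall x y (t : R), X x -> X y -> 0 <= t <= 1 ->
  X (t *: x + (1 - t) *: y).

Definition contains_cube X (c : 'rV[R]_n) (e : R) :=
  forall x : 'rV[R]_n, (forall i, `|x 0 i - c 0 i| <= e) -> X x.

(** A stand-in for the interior of [X]: as a countable union of boxes with rational corners it is
    measurable by construction. Indices that encode no pair, or a box not inside [X], contribute
    nothing. *)
Definition rat_kernel X : set 'rV[R]_n :=
  \bigcup_k (if unpickle k is Some ab then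
    [set x | box (map_mx ratr (ab.1 : 'rV[rat]_n)) (map_mx ratr (ab.2 : 'rV[rat]_n)) x /\
      box (map_mx ratr ab.1) (map_mx ratr ab.2) `<=` X] else set0).

Lemma rat_kernel_sub X : rat_kernel X `<=` X.
Proof. by move=> x [k _]; case: unpickle => // ab [/[swap]]; apply. Qed.

Lemma rat_kernel_measurable X : vol_measurable (rat_kernel X).
Proof.
have m0 := caratheodory_measurable_set0 (@outer_vol R n n_gt0).
apply: vol_measurable_bigcup => // k; case: unpickle => [[a b]|] //=.
have [sub|nsub] := pselect (box (map_mx ratr a) (map_mx ratr b) `<=` X).
  rewrite (_ : mkset _ = box (map_mx ratr a) (map_mx ratr b)); last first.
    by apply/seteqP; split => [x []|x].
  exact: box_measurable.
by rewrite (_ : mkset _ = set0) //; apply/seteqP; split => [x []|x].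
Qed.

Lemma rat_kernelP X (y : 'rV[R]_n) (e : R) :
  0 < e -> contains_cube X y e -> rat_kernel X y.
Proof.
move=> e0 cube.
have /choice [a ya] (i : 'I_n) : exists q : rat, y 0 i - e < ratr q < y 0 i.
  have [|q] := @rat_in_itvoo R (y 0 i - e) (y 0 i); last by rewrite in_itv; exists q.
  by rewrite ltrBlDr ltrDl.
have /choice [b yb] (i : 'I_n) : exists q : rat, y 0 i < ratr q < y 0 i + e.
  have [|q] := @rat_in_itvoo R (y 0 i) (y 0 i + e); last by rewrite in_itv; exists q.
  by rewrite ltrDl.
exists (pickle (\row_i a i : 'rV[rat]_n, \row_i b i : 'rV[rat]_n)) => //.
rewrite pickleK /=; split=> [i|x xab].
  by rewrite !mxE; have /andP[_ /ltW ->] := ya i; have /andP[/ltW] := yb i.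
apply: cube => i; have := xab i; rewrite !mxE => /andP[ax xb].
have /andP[a1 a2] := ya i; have /andP[b1 b2] := yb i.
rewrite ler_norml; apply/andP; split; lra.
Qed.

Lemma closure_approx X x (e : R) : 0 < e -> closure X x ->
  exists2 x', X x' & forall i, `|x 0 i - x' 0 i| < e.
Proof.
move=> e0 /(_ _ (nbhsx_ballx x e e0)) [x' [Xx' [_ xx']]].
by exists x' => // i; have := xx' 0 i; rewrite -ball_normE.
Qed.

(** Let [x'] in [X] be close to [x]. A point [w] near [r x + (1 - r) c] is [r x' + (1 - r) c'] with
    [c'] in the cube around [c], hence lies in [X] by convexity. The tolerance [(1 - r) e / 2] is
    spent once on [w] and once on [x']; dividing by [1 - r] leaves [c'] within [e] of [c]. *)
Lemma shrink_closure X c e r x : cvx_set X -> 0 < e -> contains_cube X c e ->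
  0 < r < 1 -> closure X x ->
  rat_kernel X (diag_affine (const_mx r) ((1 - r) *: c) x).
Proof.
move=> cvx e0 cube /andP[r0 r1] clx.
have e20 : 0 < (1 - r) * e / 2 by rewrite divr_gt0 // mulr_gt0 // subr_gt0.
apply: (rat_kernelP e20) => w wy.
have [x' Xx' xx'] := closure_approx e20 clx.
have r1' : 1 - r != 0 by rewrite gt_eqF // subr_gt0.
pose c' : 'rV[R]_n := (1 - r)^-1 *: (w - r *: x').
have -> : w = r *: x' + (1 - r) *: c' by rewrite scalerA divff // scale1r addrC subrK.
apply: cvx => //; last by rewrite !ltW.
apply: cube => i; rewrite !mxE.
have := wy i; rewrite !mxE => wyi.
have xxi := xx' i.
have -> : (1 - r)^-1 * (w 0 i - r * x' 0 i) - c 0 i =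
  (1 - r)^-1 * ((w 0 i - (r * x 0 i + (1 - r) * c 0 i)) + r * (x 0 i - x' 0 i)).
  by field.
rewrite normrM gtr0_norm ?invr_gt0 ?subr_gt0 // ler_pdivrMl ?subr_gt0 //.
apply: (le_trans (ler_normD _ _)).
have rx : `|r * (x 0 i - x' 0 i)| <= `|x 0 i - x' 0 i|.
  by rewrite normrM gtr0_norm // ler_piMl // ltW.
lra.
Qed.

Lemma vol_closure_setD_kernel X a b c e : cvx_set X -> X `<=` box a b ->
  0 < e -> contains_cube X c e -> vol (closure X `\` rat_kernel X) = 0%E.
Proof.
move=> cvx Xab e0 cube; set U := rat_kernel X.
have UX : U `<=` X by exact: rat_kernel_sub.
have mU : vol_measurable U by exact: rat_kernel_measurable.
have ab i : a 0 i <= b 0 i.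
  have /Xab /(_ i) /andP[] : X c by apply: cube => j; rewrite subrr normr0 ltW.
  exact: le_trans.
have shr r : 0 < r < 1 -> ((r ^+ n)%:E * vol (closure X) <= vol U)%E.
  move=> r01; have /andP[r0 r1] := r01.
  have -> : r ^+ n = \prod_i (const_mx r : 'rV[R]_n) 0 i.
    under eq_bigr do rewrite mxE.
    by rewrite prodr_const card_ord.
  rewrite -(@vol_diag_affine R n (closure X) _ ((1 - r) *: c)) => [|i]; last by rewrite mxE.
  by apply: le_vol => _ [x clx <-]; exact: (shrink_closure cvx e0).
have Ufin : vol U \is a fin_num.
  rewrite ge0_fin_numE ?vol_ge0 //.
  apply: (le_lt_trans (le_vol UX)); apply: (le_lt_trans (vol_le_boxvol _ ab Xab)) => //.
  exact: ltry.
(* The limit is taken between real numbers, so the closure must first have finite volume; the single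
   factor 1/2 already bounds it by [2^n] times [vol U]. *)
have half01 : 0 < (2^-1 : R) < 1 by apply/andP; split; lra.
have Cfin : vol (closure X) \is a fin_num.
  have := shr _ half01; have := vol_ge0 (closure X).
  case: (vol (closure X)) => [s| |] // _.
  rewrite gt0_muley ?lte_fin ?exprn_gt0 ?invr_gt0 // => ?.
  by move: Ufin; rewrite ge0_fin_numE ?vol_ge0 // ltNge => /negP.
have CU : (vol (closure X) <= vol U)%E.
  rewrite -(fineK Cfin) -(fineK Ufin) lee_fin.
  have := @le_at1 (fun r => r ^+ n * fine (vol (closure X))) (fun=> fine (vol U)).
  rewrite expr1n mul1r; apply.
  - apply: continuousM; last exact: cst_continuous.
    exact: exprn_continuous.
  - exact: cst_continuous.
  - move=> r /shr; rewrite -(fineK Cfin) -(fineK Ufin) -EFinM lee_fin.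
    by rewrite fineK // fineK.
(* Measurability of [U] splits [vol (closure X)] into [vol U] plus the volume of the difference; as
   [vol U] is finite and not smaller than the total, the difference is null. *)
have := mU (closure X); rewrite setIidr; last exact: subset_trans (@subset_closure _ X).
move=> E; apply/eqP; rewrite eq_le vol_ge0 andbT setDE.
by move: CU; rewrite E -[leRHS]adde0 leeD2lE.
Qed.

Lemma vol_closure_setD X a b c e : cvx_set X -> X `<=` box a b ->
  0 < e -> contains_cube X c e -> vol (closure X `\` X) = 0%E.
Proof.
move=> cvx Xab e0 cube; apply/eqP; rewrite eq_le vol_ge0 andbT.
rewrite -(vol_closure_setD_kernel cvx Xab e0 cube) le_vol // => x [clx nX].
by split => // /rat_kernel_sub.
Qed.

(** [X] is its rational kernel together with a subset of the null set that separates the kernel from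
    the closure. *)
Lemma convex_measurable X a b c e : cvx_set X -> X `<=` box a b ->
  0 < e -> contains_cube X c e -> vol_measurable X.
Proof.
move=> cvx Xab e0 cube.
have -> : X = rat_kernel X `|` (X `\` rat_kernel X).
  apply/seteqP; split=> x; last by case=> [/rat_kernel_sub|[]].
  by move=> Xx; have [?|?] := pselect (rat_kernel X x); [left|right].
apply: vol_measurableU => //; first exact: rat_kernel_measurable.
apply: vol_null_measurable => //; apply/eqP; rewrite eq_le vol_ge0 andbT.
rewrite -(vol_closure_setD_kernel cvx Xab e0 cube) le_vol //.
by move=> x [Xx nk]; split => //; exact: subset_closure.
Qed.

End ConvexBodies.

(** * Towers *)

Section PowerBounds.
Variable R : realType.
Implicit Types r s : R.

Lemma powR_continuous1 s : {for 1, continuous (fun r : R => r `^ s)}.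
Proof.
apply/differentiable_continuous/derivable1_diffP/derivable_powR.
by rewrite in_itv /= ltr01.
Qed.

Lemma ln_le_subr1 r : 0 < r -> ln r <= r - 1.
Proof.
by move=> r0; have := @le_ln1Dx R (r - 1); rewrite addrCA subrr addr0; apply; lra.
Qed.

(** From [exp (- s ln r) >= 1 - s ln r] and [ln r <= r - 1]. For [r < 1], together with
    [powR_ge_tangent], it traps [(1 - r^s) / (1 - r)] between [s r^s] and [s / r], which both tend
    to [s]. *)
Lemma mulr_powR_le r s : 0 < r -> 0 < s -> s * r `^ s * (1 - r) <= 1 - r `^ s.
Proof.
move=> r0 s0; rewrite lerBrDr.
have -> : s * r `^ s * (1 - r) + r `^ s = r `^ s * (1 + s * (1 - r)) by ring.
rewrite -ler_pdivlMl ?powR_gt0 // mulr1 -powRN /powR gt_eqF //.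
apply: le_trans (expR_ge1Dx _); rewrite lerD2l mulNr -mulrN ler_pM2l //.
by have := ln_le_subr1 r0; lra.
Qed.

Lemma powR_ge_tangent r s : 0 < r -> 0 < s -> r * (1 - r `^ s) <= s * (1 - r).
Proof.
move=> r0 s0; have := expR_ge1Dx (s * ln r).
have -> : expR (s * ln r) = r `^ s by rewrite /powR gt_eqF.
have : ln r^-1 <= r^-1 - 1 by rewrite ln_le_subr1 ?invr_gt0.
rewrite lnV ?posrE // => lnr powr.
have lnr' : r * (- ln r) <= 1 - r.
  by have := ler_pM2l r0 (- ln r) (r^-1 - 1); rewrite lnr mulrBr mulr1 divff ?gt_eqF // => ->.
have : r * (1 - r `^ s) <= r * (s * - ln r) by rewrite ler_pM2l //; lra.
move=> /le_trans; apply.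
by rewrite mulrCA ler_pM2l.
Qed.

End PowerBounds.

(** * Coordinates in dimensions [d + 1] and [d + 2] *)

Section Coordinates.
Variables (R : realType) (d : nat).

(* Locked, so that rewriting with [mxE] does not unfold them. *)
Definition mk2 (x : 'rV[R]_d) (t : R) : 'rV[R]_(d + 1) :=
  locked (row_mx x (const_mx t)).
Definition mk3 (x : 'rV[R]_d) (y z : R) : 'rV[R]_(d + 2) :=
  locked (row_mx x (\row_j (if j == ord0 then y else z))).
Definition pt (u : 'rV[R]_(d + 1)) : R := rsubmx u ord0 ord0.

Lemma forall_ord_addn1 (P : 'I_(d + 1) -> Prop) :
  (forall i, P (lshift 1 i)) -> P (rshift d ord0) -> forall j, P j.
Proof. by move=> Pl Pr j; case: (split_ordP j) => k ->; rewrite ?(ord1 k). Qed.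

Lemma forall_ord_addn2 (P : 'I_(d + 2) -> Prop) :
  (forall i, P (lshift 2 i)) -> P (rshift d ord0) -> P (rshift d ord_max) ->
  forall j, P j.
Proof.
move=> Pl P0 P1 j; case: (split_ordP j) => k -> //.
by case: k => -[|[|k]] //= lk; [move: P0|move: P1]; congr P; apply: val_inj.
Qed.

Lemma prod_ord_addn1 (F : 'I_(d + 1) -> R) :
  \prod_j F j = (\prod_(i < d) F (lshift 1 i)) * F (rshift d ord0).
Proof. by rewrite big_split_ord /= big_ord1. Qed.

Lemma prod_ord_addn2 (F : 'I_(d + 2) -> R) :
  \prod_j F j = (\prod_(i < d) F (lshift 2 i)) * F (rshift d ord0) * F (rshift d ord_max).
Proof.
rewrite big_split_ord /= big_ord_recl big_ord1 mulrA.
by congr (_ * F _); apply: val_inj.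
Qed.

Lemma mk2_x x t i : mk2 x t 0 (lshift 1 i) = x 0 i.
Proof. by rewrite /mk2 -lock row_mxEl. Qed.
Lemma mk2_t x t : mk2 x t 0 (rshift d ord0) = t.
Proof. by rewrite /mk2 -lock row_mxEr mxE. Qed.
Lemma mk3_x x y z i : mk3 x y z 0 (lshift 2 i) = x 0 i.
Proof. by rewrite /mk3 -lock row_mxEl. Qed.
Lemma mk3_y x y z : mk3 x y z 0 (rshift d ord0) = y.
Proof. by rewrite /mk3 -lock row_mxEr mxE eqxx. Qed.
Lemma mk3_z x y z : mk3 x y z 0 (rshift d ord_max) = z.
Proof. by rewrite /mk3 -lock row_mxEr mxE. Qed.
Lemma ptE u : pt u = u 0 (rshift d ord0).
Proof. by rewrite /pt mxE. Qed.
Lemma lsubmx1E (u : 'rV[R]_(d + 1)) i : lsubmx u 0 i = u 0 (lshift 1 i).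
Proof. by rewrite mxE. Qed.
Lemma pxE (w : 'rV[R]_(d + 2)) i : px w 0 i = w 0 (lshift 2 i).
Proof. by rewrite /px mxE. Qed.
Lemma pyE (w : 'rV[R]_(d + 2)) : py w = w 0 (rshift d ord0).
Proof. by rewrite /py mxE. Qed.
Lemma pzE (w : 'rV[R]_(d + 2)) : pz w = w 0 (rshift d ord_max).
Proof. by rewrite /pz mxE. Qed.

Definition mk2E := (mk2_x, mk2_t).
Definition mk3E := (mk3_x, mk3_y, mk3_z).

Lemma mk2K x t : lsubmx (mk2 x t) = x /\ pt (mk2 x t) = t.
Proof. by split; [rewrite /mk2 -lock; exact: row_mxKl|rewrite ptE mk2_t]. Qed.

Lemma mk3K x y z : [/\ px (mk3 x y z) = x, py (mk3 x y z) = y & pz (mk3 x y z) = z].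
Proof. by split; [rewrite /px /mk3 -lock; exact: row_mxKl|rewrite pyE mk3_y|rewrite pzE mk3_z]. Qed.

End Coordinates.

(** * The volume of a tower *)

Section Tower.
Variables (R : realType) (d : nat) (q : R).
Hypothesis q_ge1 : 1 <= q.
Implicit Types (G : set 'rV[R]_(d + 1)) (r : R).

(* The base point (u, t) of a point (zu, z^q t, z) of a tower. *)
Definition unz (w : 'rV[R]_(d + 2)) : 'rV[R]_(d + 1) :=
  mk2 ((pz w)^-1 *: px w) (py w / (pz w) `^ q).

Definition tower G : set 'rV[R]_(d + 2) := [set w | 0 < pz w <= 1 /\ G (unz w)].

Let s : R := q + d%:R + 1.
Let n1_gt0 : (0 < d + 1)%N. Proof. by rewrite addn1. Qed.
Let n2_gt0 : (0 < d + 2)%N. Proof. by rewrite addn2. Qed.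
Let q_gt0 : 0 < q. Proof. exact: lt_le_trans q_ge1. Qed.
Let s_gt0 : 0 < s. Proof. by rewrite /s -addrA ltr_wpDr // addr_ge0. Qed.

Let powq_le x y : 0 <= x -> x <= y -> x `^ q <= y `^ q.
Proof.
move=> x0 xy; apply: ge0_ler_powR => //; rewrite ?nnegrE //; first exact: ltW.
exact: le_trans xy.
Qed.

Let unz_x w i : unz w 0 (lshift 1 i) = (pz w)^-1 * px w 0 i.
Proof. by rewrite mk2_x mxE. Qed.
Let unz_t w : unz w 0 (rshift d ord0) = py w / (pz w) `^ q.
Proof. by rewrite mk2_t. Qed.

(** Scaling by [S r] multiplies the height by [r] and keeps the base point [unz]. Its determinant
    has [d] factors [r], one [r^q] and one more [r], which is the origin of the exponent
    [s = q + d + 1]. *)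
Let S r : 'rV[R]_(d + 2) := mk3 (const_mx r) (r `^ q) r.

Let S_gt0 r : 0 < r -> forall j, 0 < S r 0 j.
Proof.
by move=> r0; apply: forall_ord_addn2 => [i||]; rewrite mk3E ?mxE ?powR_gt0.
Qed.

Let prod_S r : 0 < r -> \prod_j S r 0 j = r `^ s.
Proof.
move=> r0; rewrite prod_ord_addn2 !mk3E.
under eq_bigr do rewrite mk3E mxE.
have rD x y : r `^ x * r `^ y = r `^ (x + y) by rewrite powRD // (gt_eqF r0) implybT.
rewrite prodr_const card_ord -powR_mulrn ?ltW // rD.
rewrite -[X in _ * X](powRr1 (ltW r0)) rD.
by congr (_ `^ _); rewrite /s; ring.
Qed.

Lemma tower_below G r : 0 < r <= 1 ->
  tower G `&` [set w | pz w <= r] = diag_affine (S r) 0 @` tower G.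
Proof.
move=> /andP[r0 r1].
have Spz w : pz (diag_affine (S r) 0 w) = r * pz w.
  by rewrite !pzE !mxE mk3E addr0.
have Sunz w : 0 < pz w -> unz (diag_affine (S r) 0 w) = unz w.
  move=> z0; apply/rowP; apply: forall_ord_addn1 => [i|].
    rewrite !unz_x Spz !pxE !mxE mk3E mxE addr0.
    by field; rewrite !gt_eqF.
  rewrite !unz_t Spz !pyE !mxE mk3E addr0 powRM ?ltW //.
  by field; rewrite !gt_eqF ?powR_gt0.
apply/seteqP; split => [w [[/andP[z0 z1] Gw] /= zr]|_ [w [/andP[z0 z1] Gw] <-]].
  pose w' := mk3 (r^-1 *: px w) (py w / r `^ q) (pz w / r).
  have ww' : diag_affine (S r) 0 w' = w.
    apply/rowP; apply: forall_ord_addn2 => [i||]; rewrite !mxE !mk3E addr0.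
    - by rewrite !mxE mulrA divff ?gt_eqF // mul1r.
    - by rewrite pyE mulrC divfK ?gt_eqF ?powR_gt0.
    - by rewrite pzE mulrC divfK ?gt_eqF.
  have w'z : pz w' = pz w / r by rewrite pzE mk3E.
  have w'0 : 0 < pz w' by rewrite w'z divr_gt0.
  exists w' => //; split; first by rewrite w'0 w'z ler_pdivrMr // mul1r.
  by rewrite -Sunz // ww'.
rewrite /tower /= Spz; split; last by rewrite ger_pMr.
split; last by rewrite Sunz.
by rewrite mulr_gt0 //= mulr_ile1 // ltW.
Qed.

(** The cut is along the half-space below height [r], which is measurable, so [G] can be any set. *)
Lemma vol_tower_slab G r : 0 < r <= 1 -> vol (tower G) =
  ((r `^ s)%R%:E * vol (tower G) + vol (tower G `&` [set w | (r < pz w)%R]))%E.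
Proof.
move=> r01; have /andP[r0 r1] := r01.
have mH : vol_measurable [set w : 'rV[R]_(d + 2) | pz w <= r].
  apply: (@halfspace_measurable _ _ n2_gt0 (rshift d ord_max) r) => w /=; rewrite pzE //.
  exact: ltW.
rewrite {1}(mH (tower G)) tower_below // vol_diag_affine //; last exact: S_gt0.
rewrite prod_S //; congr (_ + vol (_ `&` _))%E.
by apply/seteqP; split => w /=; rewrite ltNge => /negP.
Qed.

Lemma boxvol_mk3 (x x' : 'rV[R]_d) y y' z z' : boxvol (mk3 x y z) (mk3 x' y' z') =
  (\prod_i (x' 0 i - x 0 i)) * (y' - y) * (z' - z).
Proof.
rewrite /boxvol prod_ord_addn2 !mk3E; congr (_ * _ * _).
by apply: eq_bigr => i _; rewrite !mk3E.
Qed.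

Lemma boxvol_mk2 (x x' : 'rV[R]_d) t t' : boxvol (mk2 x t) (mk2 x' t') =
  (\prod_i (x' 0 i - x 0 i)) * (t' - t).
Proof.
rewrite /boxvol prod_ord_addn1 !mk2E; congr (_ * _).
by apply: eq_bigr => i _; rewrite !mk2E.
Qed.

Section BoxTower.
Variables (a b : 'rV[R]_d) (at_ bt : R).
Hypotheses (a_ge0 : forall i, 0 <= a 0 i) (ab : forall i, a 0 i <= b 0 i).
Hypotheses (at_ge0 : 0 <= at_) (abt : at_ <= bt).
Let B := box (mk2 a at_) (mk2 b bt).

Let tower_boxP w : tower B w -> [/\ 0 < pz w <= 1,
  forall i, pz w * a 0 i <= px w 0 i <= pz w * b 0 i &
  (pz w) `^ q * at_ <= py w <= (pz w) `^ q * bt].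
Proof.
move=> [z01 Bw]; split => //; have /andP[z0 z1] := z01.
  move=> i; have := Bw (lshift 1 i); rewrite unz_x !mk2E.
  by rewrite ler_pdivlMl // ler_pdivrMl.
have := Bw (rshift d ord0); rewrite unz_t !mk2E.
by rewrite ler_pdivlMr ?powR_gt0 // ler_pdivrMr ?powR_gt0 // ![_ * _ `^ _]mulrC.
Qed.

Let b_ge0 i : 0 <= b 0 i. Proof. exact: le_trans (ab i). Qed.
Let bt_ge0 : 0 <= bt. Proof. exact: le_trans abt. Qed.

(** Since the coordinates are nonnegative, the corners of the section at height [z] grow with [z],
    so lower corners are taken at [r] and upper corners at 1. *)
Lemma tower_box_above r : 0 <= r ->
  tower B `&` [set w | (r < pz w)%R] `<=` box (mk3 (r *: a) (r `^ q * at_) r) (mk3 b bt 1).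
Proof.
move=> r0 w [/tower_boxP[/andP[z0 z1] wx wy] /= rz].
apply: forall_ord_addn2 => [i||]; rewrite !mk3E.
- rewrite !mxE -pxE; have /andP[w1 w2] := wx i; apply/andP; split.
    by apply: le_trans w1; rewrite ler_wpM2r // ltW.
  by apply: le_trans w2 _; rewrite ler_piMl.
- rewrite -pyE; have /andP[w1 w2] := wy; apply/andP; split.
    by apply: le_trans w1; rewrite ler_wpM2r // powq_le // ltW.
  apply: le_trans w2 _; rewrite ler_piMl //.
  by rewrite (le_trans (ge1r_powR _ q_ge1)) // ?z0.
- by rewrite -pzE z1 ltW.
Qed.

Let above_le r : 0 <= r <= 1 -> forall j,
  mk3 (r *: a) (r `^ q * at_) r 0 j <= mk3 b bt 1 0 j.
Proof.
move=> /andP[r0 r1]; apply: forall_ord_addn2 => [i||]; rewrite !mk3E // ?mxE.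
  by apply: le_trans (ab i); rewrite ler_piMl.
apply: le_trans abt; rewrite ler_piMl //.
by have := powq_le r0 r1; rewrite powR1.
Qed.

Lemma vol_tower_box_fin : vol (tower B) \is a fin_num.
Proof.
rewrite ge0_fin_numE ?vol_ge0 //.
(* For [r = 0] the slab is the whole tower, as heights in a tower are positive. *)
have /le_lt_trans : (vol (tower B) <=
    (boxvol (mk3 (0 *: a) (0 `^ q * at_) 0) (mk3 b bt 1))%R%:E)%E.
  apply: vol_le_boxvol => //; first by apply: above_le; rewrite lexx ler01.
  move=> w tw; apply: tower_box_above => //; split => //.
  by case: tw => /andP[].
by apply; exact: ltry.
Qed.

(** The slab above height [r] has volume at most [g r * (1 - r)], hence
    [V (1 - r^s) <= g r * (1 - r)] and, by [mulr_powR_le], [s r^s V <= g r]. At the limit [g 1] is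
    the volume of the base box. *)
Lemma vol_tower_box_le : (vol (tower B) <= (s^-1 * boxvol (mk2 a at_) (mk2 b bt))%R%:E)%E.
Proof.
rewrite -(fineK vol_tower_box_fin) lee_fin ler_pdivlMl //; set V := fine _.
have V0 : 0 <= V by rewrite fine_ge0 // vol_ge0.
pose g r := (\prod_i (b 0 i - r * a 0 i)) * (bt - r `^ q * at_).
have -> : boxvol (mk2 a at_) (mk2 b bt) = g 1.
  rewrite boxvol_mk2 /g powR1 mul1r; congr (_ * _).
  by apply: eq_bigr => i _; rewrite mul1r.
have := @le_at1 R (fun r => s * r `^ s * V) g; rewrite powR1 mulr1; apply.
- apply: continuousM; last exact: cst_continuous.
  by apply: continuousM; [exact: cst_continuous|exact: powR_continuous1].
- apply: continuousM.
    apply: cvg_big => [|i _]; first exact: mul_continuous.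
    apply: cvgB; first exact: cvg_cst.
    by apply: cvgM; [exact: cvg_id|exact: cvg_cst].
  apply: continuousB; first exact: cst_continuous.
  by apply: continuousM; [exact: powR_continuous1|exact: cst_continuous].
move=> r /andP[r0 r1]; have r01 : 0 < r <= 1 by rewrite r0 ltW.
have := vol_tower_slab B r01.
have : (vol (tower B `&` [set w | (r < pz w)%R])
    <= (boxvol (mk3 (r *: a) (r `^ q * at_) r) (mk3 b bt 1))%R%:E)%E.
  apply: vol_le_boxvol => //; last by apply: tower_box_above; exact: ltW.
  by apply: above_le; rewrite !ltW.
rewrite boxvol_mk3 (_ : \prod_i _ = \prod_i (b 0 i - r * a 0 i)); last first.
  by apply: eq_bigr => i _; rewrite mxE.
rewrite -/(g r) => le eqV.
have {eqV le} : (vol (tower B) <= (r `^ s)%R%:E * vol (tower B) + (g r * (1 - r))%R%:E)%E.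
  by rewrite {1}eqV leeD2l.
rewrite -(fineK vol_tower_box_fin) -EFinM -EFinD lee_fin -/V => le.
have r1' : 0 < 1 - r by rewrite subr_gt0.
rewrite -(ler_pM2r r1').
have := ler_wpM2r V0 (mulr_powR_le r0 s_gt0); lra.
Qed.

End BoxTower.

Lemma vol_tower_le G : (forall u, G u -> forall j, 0 <= u 0 j) ->
  (vol (tower G) <= (s^-1)%R%:E * vol G)%E.
Proof.
move=> G0; rewrite -lee_pdivrMl ?invr_gt0 // invrK.
apply: le_ereal_inf_tmp => _ [a [b [ab cov ->]]].
rewrite -lee_pdivlMl //.
(* Covering boxes may leave the nonnegative orthant, where the bound for boxes does not apply.
   Clamping their corners at 0 still covers [G] and lengthens no side. *)
pose pos (x : 'rV[R]_(d + 1)) : 'rV[R]_(d + 1) := \row_j Num.max 0 (x 0 j).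
have posab k j : pos (a k) 0 j <= pos (b k) 0 j.
  by rewrite !mxE ge_max !le_max lexx ab orbT.
have mk2S (u : 'rV[R]_(d + 1)) : mk2 (lsubmx u) (pt u) = u.
  by apply/rowP; apply: forall_ord_addn1 => [i|]; rewrite mk2E ?mxE ?ptE.
apply: (@le_trans _ _ (\sum_(0 <= k <oo) vol (tower (box (pos (a k)) (pos (b k)))))%E).
  apply: le_trans (@vol_sigma_subadditive _ _ _).
  apply: le_vol => w [z01 Gw]; have [k _ ck] := cov _ Gw.
  exists k => //; split => // j; rewrite !mxE.
  by have /andP[ax xb] := ck j; rewrite ge_max le_max ax xb G0 // orbT.
rewrite -nneseriesZl => [|k _]; last by rewrite lee_fin boxvol_ge0.
apply: lee_nneseries => k _; first by rewrite vol_ge0.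
rewrite -(mk2S (pos (a k))) -(mk2S (pos (b k))).
apply: le_trans (vol_tower_box_le _ _ _ _) _ => [i|i|||].
- by rewrite !mxE le_max lexx.
- by rewrite !lsubmx1E.
- by rewrite ptE !mxE le_max lexx.
- by rewrite !ptE.
rewrite !mk2S -EFinM lee_fin ler_pM2l ?invr_gt0 //.
apply: ler_prod => j _; rewrite subr_ge0 posab /= !mxE.
by have := ab k j; rewrite /Num.max; do 2!case: ifPn; rewrite -?leNgt; lra.
Qed.

(** With lower corner at the origin the sections increase with the height, so the slab above [r]
    contains the section at height [r] times an interval of length [1 - r]. *)
Lemma vol_tower_box0_ge (b : 'rV[R]_d) bt : (forall i, 0 <= b 0 i) -> 0 <= bt ->
  ((s^-1 * boxvol (mk2 0 0) (mk2 b bt))%R%:E <= vol (tower (box (mk2 0%R 0%R) (mk2 b bt))))%E.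
Proof.
move=> b0 bt0; set B := box _ _.
have Vfin : vol (tower B) \is a fin_num.
  by apply: vol_tower_box_fin => // i; rewrite mxE.
rewrite -(fineK Vfin) lee_fin ler_pdivrMl //; set V := fine _.
have V0 : 0 <= V by rewrite fine_ge0 // vol_ge0.
set W := boxvol _ _.
have := @le_at1 R (fun r => r `^ s * W) (fun=> s * V); rewrite powR1 mul1r; apply.
- by apply: continuousM; [exact: powR_continuous1|exact: cst_continuous].
- exact: cst_continuous.
move=> r /andP[r0 r1]; have r01 : 0 < r <= 1 by rewrite r0 ltW.
have r1' : 0 < 1 - r by rewrite subr_gt0.
have rq0 := powR_gt0 q r0.
have le0 : forall j, mk3 0 0 r 0 j <= mk3 (r *: b) (r `^ q * bt) 1 0 j.
  apply: forall_ord_addn2 => [i||]; rewrite !mk3E ?mxE ?mulr_ge0 //; exact: ltW.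
have lo : ((\prod_i (r * b 0 i) * (r `^ q * bt) * (1 - r))%R%:E
           <= vol (tower B `&` [set w | (r < pz w)%R]))%E.
  have -> : \prod_i (r * b 0 i) * (r `^ q * bt) * (1 - r) =
            boxvol (mk3 0 0 r) (mk3 (r *: b) (r `^ q * bt) 1).
    rewrite boxvol_mk3 subr0; congr (_ * _ * _).
    by apply: eq_bigr => i _; rewrite !mxE subr0.
  rewrite -vol_box //.
  (* The covering box is closed while the slab requires [r < z]; the missing bottom face is null. *)
  pose F := box (mk3 0 0 r) (mk3 (r *: b) (r `^ q * bt) r).
  have F0 : vol F = 0%E.
    rewrite vol_box // ?boxvol_mk3 ?subrr ?mulr0 //.
    by apply: forall_ord_addn2 => [i||]; rewrite !mk3E ?mxE ?mulr_ge0 //; exact: ltW.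
  rewrite -[leRHS]adde0 -F0; apply: le_trans (volU_le _ _ _) => //.
  apply: le_vol => w wb.
  have := wb (rshift d ord_max); rewrite !mk3E -pzE => /andP[rz z1].
  have z0 : 0 < pz w by exact: lt_le_trans rz.
  have := wb (rshift d ord0); rewrite !mk3E -pyE => /andP[y0 y1].
  have wx i : 0 <= px w 0 i <= r * b 0 i.
    by have := wb (lshift 2 i); rewrite !mk3E -pxE !mxE.
  have [rz'|zr] := ltP r (pz w); [left|right]; last first.
    apply: forall_ord_addn2 => [i||]; rewrite !mk3E.
    - by have := wx i; rewrite pxE !mxE.
    - by rewrite -pyE y0.
    - by rewrite -pzE rz.
  split => //; split; first by rewrite z0.
  apply: forall_ord_addn1 => [i|]; rewrite ?unz_x ?unz_t !mk2E.
    have /andP[x0 x1] := wx i.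
    rewrite (_ : (0 : 'rV[R]_d) 0 i = 0); last by rewrite mxE.
    rewrite mulr_ge0 ?invr_ge0 ?(ltW z0) //=.
    by rewrite ler_pdivrMl // (le_trans x1) // ler_wpM2r.
  rewrite divr_ge0 ?powR_ge0 //= ler_pdivrMr ?powR_gt0 // mulrC (le_trans y1) //.
  by rewrite ler_wpM2r // powq_le // ltW.
have := vol_tower_slab B r01.
have PW : \prod_i (r * b 0 i) * (r `^ q * bt) = r^-1 * r `^ s * W.
  have -> : r `^ s = r ^+ d * r `^ q * r.
    rewrite -(prod_S r0) prod_ord_addn2 !mk3E.
    by under eq_bigr do rewrite mk3E mxE; rewrite prodr_const card_ord.
  rewrite big_split /= prodr_const card_ord /W boxvol_mk2 subr0.
  have -> : \prod_i (b 0 i - (0 : 'rV[R]_d) 0 i) = \prod_i b 0 i.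
    by apply: eq_bigr => i _; rewrite mxE subr0.
  by field; rewrite gt_eqF.
rewrite PW in lo => eqV.
have : ((r `^ s)%R%:E * vol (tower B) + (r^-1 * r `^ s * W * (1 - r))%R%:E <= vol (tower B))%E.
  by rewrite [leRHS]eqV leeD2l.
rewrite -(fineK Vfin) -EFinM -EFinD lee_fin -/V => le.
rewrite -(ler_pM2r r1').
have t := ler_wpM2r V0 (powR_ge_tangent r0 s_gt0).
have : r * (r^-1 * r `^ s * W * (1 - r)) <= r * (V - r `^ s * V).
  by rewrite ler_pM2l //; lra.
rewrite !mulrA divff ?gt_eqF // mul1r; lra.
Qed.

(** The upper bounds for [G] and for its complement in the box [W] add up, by measurability of [G],
    to the lower bound for [W]; so neither of them can be strict. *)
Lemma vol_tower G (b : 'rV[R]_d) bt : (forall i, 0 <= b 0 i) -> 0 <= bt ->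
  G `<=` box (mk2 0 0) (mk2 b bt) -> vol_measurable G ->
  vol (tower G) = ((s^-1)%R%:E * vol G)%E.
Proof.
move=> b0 bt0 GW mG; set W := box _ _ in GW.
have le0b : forall j, mk2 0 0 0 j <= mk2 b bt 0 j.
  by apply: forall_ord_addn1 => [i|]; rewrite !mk2E ?mxE.
have W0 u : W u -> forall j, 0 <= u 0 j.
  move=> Wu; apply: forall_ord_addn1 => [i|].
    by have /andP[] := Wu (lshift 1 i); rewrite mk2E mxE.
  by have /andP[] := Wu (rshift d ord0); rewrite mk2E.
have leG : (vol (tower G) <= (s^-1)%R%:E * vol G)%E by apply: vol_tower_le => u /GW/W0.
have leC : (vol (tower (W `\` G)) <= (s^-1)%R%:E * vol (W `\` G))%E.
  by apply: vol_tower_le => u [/W0].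
have eqW : vol W = (vol G + vol (W `\` G))%E by rewrite (mG W) setIidr.
have Wfin : vol W \is a fin_num by rewrite vol_box.
have Gfin : vol G \is a fin_num.
  by rewrite ge0_fin_numE ?vol_ge0 // (le_lt_trans (le_vol GW)) // vol_box // ltry.
have Cfin : vol (W `\` G) \is a fin_num.
  rewrite ge0_fin_numE ?vol_ge0 // (le_lt_trans (le_vol (@subDsetl _ W G))) //.
  by rewrite vol_box // ltry.
have := vol_tower_box0_ge b0 bt0; rewrite EFinM -vol_box // -/W => geW.
have : (vol (tower W) <= vol (tower G) + vol (tower (W `\` G)))%E.
  apply: le_trans (volU_le _ _ _) => //; apply: le_vol => w [z01 Ww].
  by have [?|?] := pselect (G (unz w)); [left|right].
move=> /(le_trans geW) => le2.
apply/eqP; rewrite eq_le leG /=.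
rewrite -(leeD2rE _ _ (_ : ((s^-1)%R%:E * vol (W `\` G))%E \is a fin_num)); last first.
  by rewrite fin_numM.
rewrite -muleDr ?fin_num_adde_defl // -eqW (le_trans le2) // leeD2l //.
Qed.

End Tower.

(** * Convex hulls and simplices *)

Section ConvexHull.
Variables (R : realType) (n : nat).
Implicit Types (K S : set 'rV[R]_n) (f : 'rV[R]_n -> R).

(** Unnormalised weights let the induction drop the last point without rescaling the others.
    Membership in [K] is carried along because convexity of [f] at the next step requires it. *)
Lemma jensen_weighted K f m (c : 'I_m -> R) (p : 'I_m -> 'rV[R]_n) :
  cvx_set K -> convex_on K f -> (forall i, 0 <= c i) -> (forall i, K (p i)) ->
  0 < \sum_i c i ->
  K ((\sum_i c i)^-1 *: \sum_i c i *: p i) /\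
  f ((\sum_i c i)^-1 *: \sum_i c i *: p i) <= (\sum_i c i)^-1 * \sum_i c i * f (p i).
Proof.
move=> cK cf; elim: m c p => [|m IH] c p c0 Kp; first by rewrite !big_ord0 ltxx.
rewrite !big_ord_recr /=; set p' := fun i => p (widen_ord (leqnSn m) i).
set c' := fun i => c (widen_ord (leqnSn m) i).
rewrite -/(\sum_i c' i) -/(\sum_i c' i *: p' i) -/(\sum_i c' i * f (p' i)).
have c'0 i : 0 <= c' i by exact: c0.
have := IH c' p' c'0 (fun i => Kp _).
set s := \sum_i c' i; set X := \sum_i c' i *: p' i; set F := \sum_i c' i * f (p' i).
set cm := c ord_max; set pm := p ord_max => IHm s0.
have cm0 : 0 <= cm by exact: c0.
have : 0 <= s by exact: sumr_ge0.
rewrite le_eqVlt => /orP[/eqP s00|sgt0].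
  have c'E i : c' i = 0.
    by have /eqP := esym s00; rewrite psumr_eq0 // => /allP /(_ i (mem_index_enum _)) /eqP.
  have -> : X = 0 by apply: big1 => i _; rewrite c'E scale0r.
  have -> : F = 0 by apply: big1 => i _; rewrite c'E mul0r.
  rewrite -s00 !add0r scalerA mulrA mulVf; last by rewrite -s00 add0r in s0; rewrite gt_eqF.
  by rewrite scale1r mul1r; split => //; exact: Kp.
have [KX fX] := IHm sgt0.
pose t := s / (s + cm).
have t01 : 0 <= t <= 1.
  by apply/andP; split; [rewrite divr_ge0 ?ltW|rewrite ler_pdivrMr // mul1r lerDl].
have -> : (s + cm)^-1 *: (X + cm *: pm) = t *: (s^-1 *: X) + (1 - t) *: pm.
  rewrite scalerDr !scalerA /t.
  by congr (_ *: _ + _ *: _); field; rewrite !gt_eqF.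
split; first exact: (cK _ _ _ KX (Kp _) t01).
apply: (le_trans (cf _ _ _ KX (Kp _) t01)).
have /andP[t0 _] := t01.
apply: (@le_trans _ _ (t * (s^-1 * F) + (1 - t) * f pm)).
  by rewrite lerD2r ler_wpM2l.
rewrite le_eqVlt; apply/orP; left; apply/eqP; rewrite /t.
by field; rewrite !gt_eqF.
Qed.

Lemma jensen K f m (c : 'I_m -> R) (p : 'I_m -> 'rV[R]_n) :
  cvx_set K -> convex_on K f -> (forall i, 0 <= c i) -> (forall i, K (p i)) ->
  \sum_i c i = 1 -> f (\sum_i c i *: p i) <= \sum_i c i * f (p i).
Proof.
move=> cK cf c0 Kp c1; have := jensen_weighted cK cf c0 Kp.
by rewrite c1 invr1 scale1r mul1r => /(_ ltr01) [].
Qed.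

Lemma cvx_hull_convex S : cvx_set (cvx_hull S).
Proof.
move=> _ _ t [m [c [p [c0 c1 Sp ->]]]] [m' [c' [p' [c'0 c'1 Sp' ->]]]] /andP[t0 t1].
exists (m + m')%N.
exists (fun i => match fintype.split i with inl j => t * c j | inr j => (1 - t) * c' j end).
exists (fun i => match fintype.split i with inl j => p j | inr j => p' j end).
have sl (j : 'I_m) : fintype.split (lshift m' j) = inl j by exact: (unsplitK (inl j)).
have sr (j : 'I_m') : fintype.split (rshift m j) = inr j by exact: (unsplitK (inr j)).
split.
- by move=> i; case: fintype.split => j; rewrite mulr_ge0 // subr_ge0.
- rewrite big_split_ord /=.
  under eq_bigr do rewrite sl.
  under [X in _ + X]eq_bigr do rewrite sr.
  by rewrite -!mulr_sumr c1 c'1 !mulr1 addrC subrK.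
- by move=> i; case: fintype.split.
rewrite big_split_ord /= !scaler_sumr; congr (_ + _); apply: eq_bigr => i _.
  by rewrite sl scalerA.
by rewrite sr scalerA.
Qed.

Lemma sub_cvx_hull S : S `<=` cvx_hull S.
Proof.
move=> x Sx; exists 1%N, (fun=> 1), (fun=> x); split => //.
  by rewrite big_ord1.
by rewrite big_ord1 scale1r.
Qed.

Lemma affine_fun_sum (a : 'rV[R]_n) (b : R) m (c : 'I_m -> R) (p : 'I_m -> 'rV[R]_n) :
  \sum_i c i = 1 ->
  affine_fun a b (\sum_i c i *: p i) = \sum_i c i * affine_fun a b (p i).
Proof.
move=> c1; under [RHS]eq_bigr do rewrite mulrDr.
rewrite big_split /= -mulr_suml c1 mul1r; congr (_ + _).
under [RHS]eq_bigr do rewrite mulr_sumr.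
rewrite exchange_big; apply: eq_bigr => j _.
by rewrite summxE mulr_sumr; apply: eq_bigr => i _; rewrite mxE; ring.
Qed.

Lemma affine_fun_le_cvx_hull S (a : 'rV[R]_n) (b C : R) x :
  (forall y, S y -> affine_fun a b y <= C) -> cvx_hull S x -> affine_fun a b x <= C.
Proof.
move=> SC [m [c [p [c0 c1 Sp ->]]]].
rewrite affine_fun_sum // -[C]mul1r -c1 mulr_suml; apply: ler_sum => i _.
by rewrite ler_wpM2l // SC.
Qed.

End ConvexHull.

(** * An interior point of a simplex *)

Section Simplex.
Variables (R : realType) (d : nat) (v : 'I_d.+1 -> 'rV[R]_d).
Hypothesis vfree : affinely_independent v.

Let B : 'M[R]_d := \matrix_(i < d) (v (lift ord0 i) - v ord0).
(** Turns coordinates in the basis of edges into a change of barycentric weights: vertex 0 absorbs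
    minus the sum, so the total weight is preserved. *)
Let ext (w : 'rV[R]_d) (i : 'I_d.+1) : R :=
  if unlift ord0 i is Some j then w 0 j else - \sum_j w 0 j.

Let sum_ext w : \sum_i ext w i = 0.
Proof.
rewrite big_ord_recl /ext unlift_none; under [X in _ + X]eq_bigr do rewrite liftK.
by rewrite addrC subrr.
Qed.

Let sum_ext_v w : \sum_i ext w i *: v i = w *m B.
Proof.
rewrite big_ord_recl {1}/ext unlift_none mulmx_sum_row.
have -> : \sum_(i < d) ext w (lift ord0 i) *: v (lift ord0 i)
        = \sum_(i < d) w 0 i *: v (lift ord0 i).
  by apply: eq_bigr => i _; rewrite /ext liftK.
under [RHS]eq_bigr do rewrite rowK scalerBr.
by rewrite sumrB -scaler_suml scaleNr addrC.
Qed.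

Let B_unit : B \in unitmx.
Proof.
rewrite -row_free_unit; apply: inj_row_free => w wB.
have ext0 := vfree (etrans (sum_ext_v w) wB) (sum_ext w).
by apply/rowP => i; have := ext0 (lift ord0 i); rewrite /ext liftK mxE.
Qed.

(** At the barycentre all weights equal [1 / (d + 1)]. A displacement of size [e] changes each
    weight by at most [e K], with [K] the sum of the absolute entries of the inverse edge matrix,
    and [e] is chosen to keep the weights nonnegative. *)
Lemma simplex_contains_cube :
  exists c e, 0 < e /\ contains_cube (cvx_hull (range v)) c e.
Proof.
pose k : R := d.+1%:R; have k0 : 0 < k by rewrite ltr0n.
pose K : R := \sum_j \sum_i `|invmx B j i|.
have K0 : 0 <= K by apply: sumr_ge0 => j _; exact: sumr_ge0.
pose e := (k * (K + 1))^-1.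
have e0 : 0 < e by rewrite invr_gt0 mulr_gt0 // ltr_wpDl.
have eK : e * K <= k^-1.
  rewrite /e invfM -mulrA; apply: ler_piMr; first by rewrite invr_ge0 ltW.
  by rewrite ler_pdivrMl ?ltr_wpDl // mulr1 lerDl.
exists (\sum_i k^-1 *: v i), e; split => // x xc.
set c := \sum_i _ in xc; pose w := (x - c) *m invmx B.
have wle : \sum_i `|w 0 i| <= k^-1.
  apply: le_trans eK; rewrite /K exchange_big mulr_sumr.
  apply: ler_sum => i _; rewrite mxE mulr_sumr.
  apply: (le_trans (ler_norm_sum _ _ _)); apply: ler_sum => j _.
  by rewrite normrM ler_wpM2r // !mxE; exact: xc.
exists d.+1, (fun i => k^-1 + ext w i), v; split.
- move=> i; rewrite -lerBlDr sub0r; apply: le_trans wle.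
  rewrite /ext; case: unliftP => [j|] _.
    apply: (le_trans (ler_norm _)); rewrite normrN (bigD1 j) //= lerDl.
    exact: sumr_ge0.
  by rewrite opprK; apply: ler_sum => j _; exact: ler_norm.
- rewrite big_split /= sum_ext addr0 sumr_const card_ord -[X in X *+ _]mulr1 -mulrnAr.
  by rewrite mulVf // gt_eqF.
- by move=> i; exists i.
- under eq_bigr do rewrite scalerDl.
  by rewrite big_split /= sum_ext_v mulmxKV // addrC subrK.
Qed.

End Simplex.

(** * Towers of exponent 1 over convex bodies *)

Section Cone.
Variables (R : realType) (d : nat).
Implicit Types (E : set 'rV[R]_(d + 1)) (w : 'rV[R]_(d + 2)).

Lemma box_const n (K : R) (x : 'rV[R]_n) :
  (forall i, `|x 0 i| <= K) -> box (const_mx (- K)) (const_mx K) x.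
Proof. by move=> xK i; rewrite !mxE -ler_norml. Qed.

Lemma unz1_x w i : unz 1 w 0 (lshift 1 i) = (pz w)^-1 * w 0 (lshift 2 i).
Proof. by rewrite mk2_x !mxE. Qed.

Lemma unz1_t w : 0 < pz w -> unz 1 w 0 (rshift d ord0) = (pz w)^-1 * w 0 (rshift d ord0).
Proof. by move=> z0; rewrite mk2_t powRr1 ?ltW // pyE mulrC. Qed.

Lemma pz_comb w w' (s t : R) : pz (s *: w + t *: w') = s * pz w + t * pz w'.
Proof. by rewrite !pzE !mxE. Qed.

(** [unz 1] is a central projection: it maps segments to segments, with the weights multiplied by
    the heights and renormalised, which gives [s]. *)
Lemma cvx_tower1 E : cvx_set E -> cvx_set (tower 1 E).
Proof.
move=> cE w w' t [/andP[z0 z1] Ew] [/andP[z'0 z'1] Ew'] t01.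
have /andP[t0 t1] := t01.
have z''0 : 0 < t * pz w + (1 - t) * pz w'.
  move: t0; rewrite le_eqVlt => /orP[/eqP <-|t0]; first by rewrite mul0r add0r subr0 mul1r.
  by apply: ltr_pwDl; [exact: mulr_gt0|rewrite mulr_ge0 ?subr_ge0 // ltW].
have z''1 : t * pz w + (1 - t) * pz w' <= 1.
  have : t * pz w <= t * 1 by rewrite ler_wpM2l.
  have : (1 - t) * pz w' <= (1 - t) * 1 by rewrite ler_wpM2l // subr_ge0.
  lra.
split; first by rewrite pz_comb z''0.
pose s := t * pz w / (t * pz w + (1 - t) * pz w').
have s01 : 0 <= s <= 1.
  apply/andP; split; first by rewrite divr_ge0 ?mulr_ge0 // ltW.
  by rewrite ler_pdivrMr // mul1r lerDl mulr_ge0 ?subr_ge0 // ltW.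
have -> : unz 1 (t *: w + (1 - t) *: w') = s *: unz 1 w + (1 - s) *: unz 1 w'.
  have F (x y : R) : (t * pz w + (1 - t) * pz w')^-1 * (t * x + (1 - t) * y)
    = s * ((pz w)^-1 * x) + (1 - s) * ((pz w')^-1 * y).
    by rewrite /s; field; rewrite !gt_eqF.
  apply/rowP; apply: forall_ord_addn1 => [i|].
    by rewrite [RHS]mxE ![(_ *: unz _ _) _ _]mxE !unz1_x pz_comb -F !mxE.
  by rewrite [RHS]mxE ![(_ *: unz _ _) _ _]mxE !unz1_t // ?pz_comb // -F !mxE.
exact: cE.
Qed.

Lemma tower1_contains_cube E c (e : R) : 0 < e -> contains_cube E c e ->
  exists c' e', 0 < e' /\ contains_cube (tower 1 E) c' e'.
Proof.
move=> e0 cube; pose K := \sum_j `|c 0 j|.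
have cK j : `|c 0 j| <= K by rewrite /K (bigD1 j) //= lerDl sumr_ge0.
have K0 : 0 <= K by exact: sumr_ge0.
have K40 : 0 < 4 * (1 + K) by rewrite mulr_gt0 // ltr_pwDl.
(* The bound 1/4 keeps heights near 1/2 above 1/4, so dividing by the height costs a factor of at
   most 4; the error before division is at most [e' (1 + K)]. *)
pose e' := Num.min (4^-1) (e / (4 * (1 + K))).
have e'0 : 0 < e' by rewrite lt_min invr_gt0 ltr0n /= divr_gt0.
exists (mk3 (2^-1 *: lsubmx c) (2^-1 * pt c) 2^-1), e'; split => // w wc.
have e'4 : e' <= 4^-1 by rewrite ge_min lexx.
have e'e : e' * (4 * (1 + K)) <= e by rewrite -ler_pdivlMr // ge_min lexx orbT.
have /ler_normlP [z1 z2] : `|pz w - 2^-1| <= e'.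
  by have := wc (rshift d ord_max); rewrite mk3E pzE.
have z14 : 4^-1 <= pz w by lra.
have z0 : 0 < pz w by lra.
have key (x y : R) : `|y| <= K -> `|x - 2^-1 * y| <= e' -> `|(pz w)^-1 * x - y| <= e.
  move=> yK xy.
  have -> : (pz w)^-1 * x - y = (pz w)^-1 * ((x - 2^-1 * y) + y * (2^-1 - pz w)).
    by field; rewrite gt_eqF.
  rewrite normrM gtr0_norm ?invr_gt0 // ler_pdivrMl //.
  apply: (@le_trans _ _ (e' + K * e')).
    apply: (le_trans (ler_normD _ _)); apply: lerD => //.
    rewrite normrM ler_pM //; rewrite ler_norml; apply/andP; split; lra.
  apply: le_trans (ler_wpM2r (ltW e0) z14).
  by rewrite ler_pdivlMl //; lra.
split; first by rewrite z0; lra.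
apply: cube; apply: forall_ord_addn1 => [i|].
  rewrite unz1_x; apply: key; first exact: cK.
  by have := wc (lshift 2 i); rewrite mk3E !mxE.
rewrite unz1_t //; apply: key; first exact: cK.
by have := wc (rshift d ord0); rewrite mk3E ptE.
Qed.

Lemma tower1_bounded E (K : R) : (forall u, E u -> forall j, `|u 0 j| <= K) ->
  forall w, tower 1 E w -> forall j, `|w 0 j| <= K + 1.
Proof.
move=> EK w [/andP[z0 z1] /EK wK].
have K0 : 0 <= K by apply: le_trans (wK (rshift d ord0)).
have key (x : R) : `|(pz w)^-1 * x| <= K -> `|x| <= K + 1.
  rewrite normrM gtr0_norm ?invr_gt0 // ler_pdivrMl // => xK.
  by apply: (le_trans xK); have := ler_wpM2r K0 z1; lra.
apply: forall_ord_addn2 => [i||].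
- by apply: key; rewrite -unz1_x.
- by apply: key; rewrite -unz1_t.
- by rewrite -pzE gtr0_norm //; lra.
Qed.

End Cone.

(** * The two relaxations *)

Section Relaxations.
Variables (R : realType) (d : nat) (v : 'I_d.+1 -> 'rV[R]_d).
Variables (q : R) (f : 'rV[R]_d -> R) (a : 'rV[R]_d) (b : R).
Local Notation J := (cvx_hull (range v)).
Hypothesis v_free : affinely_independent v.
Hypothesis J_ge0 : forall x, J x -> forall j, 0 <= x 0 j.
Hypothesis q_ge1 : 1 <= q.
Hypothesis f_hom : homogeneous q f.
Hypothesis f_cvx : convex_on (cvx_hull (J `|` [set 0])) f.
Hypothesis mu_v : forall i, affine_fun a b (v i) = f (v i).

Let n1_gt0 : (0 < d + 1)%N. Proof. by rewrite addn1. Qed.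
Let n2_gt0 : (0 < d + 2)%N. Proof. by rewrite addn2. Qed.
Let q_gt0 : 0 < q. Proof. exact: lt_le_trans q_ge1. Qed.

Let J_cvx : cvx_set J. Proof. exact: cvx_hull_convex. Qed.

Let scaleJ_K x (z : R) : J x -> 0 <= z <= 1 -> cvx_hull (J `|` [set 0]) (z *: x).
Proof.
move=> Jx z01; have -> : z *: x = z *: x + (1 - z) *: 0 by rewrite scaler0 addr0.
by apply: cvx_hull_convex => //; apply: sub_cvx_hull; [left|right].
Qed.

Let J_K x : J x -> cvx_hull (J `|` [set 0]) x.
Proof. by move=> Jx; apply: sub_cvx_hull; left. Qed.

Let f0 : f 0 = 0.
Proof. by have := f_hom 0 (lexx 0); rewrite scale0r powR0 ?mul0r // gt_eqF. Qed.

Let fZ x (z : R) : 0 < z -> f x = z `^ q * f (z^-1 *: x).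
Proof.
by move=> z0; rewrite -f_hom ?ltW // scalerA divff ?scale1r // gt_eqF.
Qed.

Let M : R := \sum_i `|f (v i)| + 1.
Let M_ge1 : 1 <= M. Proof. by rewrite lerDr sumr_ge0. Qed.

Let f_le_mu x : J x -> f x <= affine_fun a b x.
Proof.
move=> [m [c [p [c0 c1 pv ->]]]]; rewrite affine_fun_sum //.
have -> : \sum_i c i * affine_fun a b (p i) = \sum_i c i * f (p i).
  by apply: eq_bigr => i _; have [k _ <-] := pv i; rewrite mu_v.
apply: (jensen (K := cvx_hull (J `|` [set 0]))) => //; first exact: cvx_hull_convex.
by move=> i; apply/J_K/sub_cvx_hull.
Qed.

Let mu_le_M x : J x -> affine_fun a b x + 1 <= M.
Proof.
move=> Jx; rewrite lerD2r; apply: affine_fun_le_cvx_hull Jx => _ [i _ <-].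
by rewrite mu_v (le_trans (ler_norm _)) // (bigD1 i) //= lerDl sumr_ge0.
Qed.

Let K0 : R := \sum_i \sum_j `|v i 0 j|.
Let J_bounded x : J x -> forall j, `|x 0 j| <= K0.
Proof.
move=> Jx j; rewrite ger0_norm; last exact: J_ge0.
have coord y : affine_fun (delta_mx 0 j) 0 y = y 0 j.
  rewrite /affine_fun addr0 (bigD1 j) //= mxE !eqxx mul1r big1 ?addr0 // => i ij.
  by rewrite mxE (negbTE ij) andbF mul0r.
rewrite -coord; apply: affine_fun_le_cvx_hull Jx => _ [i _ <-]; rewrite coord.
rewrite (le_trans (ler_norm _)) // /K0 (bigD1 i) //= (bigD1 j) //= -addrA lerDl.
by rewrite addr_ge0 ?sumr_ge0 // => k _; rewrite sumr_ge0.
Qed.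

(* Reflecting [x] through an interior point [c] keeps it in [J] after
   contraction, so [f c] is bounded by a convex combination of [f x] and [M]. *)
Let f_lower_bound : exists m, forall x, J x -> m <= f x.
Proof.
have [c [e [e0 cube]]] := simplex_contains_cube v_free.
have Jc : J c by apply: cube => i; rewrite subrr normr0 ltW.
have K00 : 0 <= K0 by apply: sumr_ge0 => i _; exact: sumr_ge0.
have K1 : 0 < 2 * K0 + 1 by lra.
(* Coordinates of [x - c] are at most [2 K0] in absolute value, so the reflected point stays within
   [e] of [c]. *)
pose l := e / (2 * K0 + 1); have l0 : 0 < l by rewrite divr_gt0.
exists (((1 + l) * f c - M) / l) => x Jx.
pose y := c - l *: (x - c).
have Jy : J y.
  apply: cube => i; rewrite !mxE addrAC subrr add0r normrN normrM gtr0_norm //.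
  rewrite -mulrAC ler_pdivrMr // ler_pM2l // (le_trans (ler_normB _ _)) //.
  by have := J_bounded Jx i; have := J_bounded Jc i; lra.
have l1 : 0 < 1 + l by lra.
have t01 : 0 <= (1 + l)^-1 <= 1.
  by rewrite invr_ge0 ltW //= invf_le1 //; lra.
have := f_cvx (J_K Jy) (J_K Jx) t01.
have -> : (1 + l)^-1 *: y + (1 - (1 + l)^-1) *: x = c.
  by apply/rowP => i; rewrite !mxE; field; rewrite gt_eqF.
have yM : f y <= M by have := f_le_mu Jy; have := mu_le_M Jy; lra.
rewrite ler_pdivrMr // => fc.
have : (1 + l) * f c <= (1 + l) * ((1 + l)^-1 * f y + (1 - (1 + l)^-1) * f x).
  by rewrite ler_pM2l.
have -> : (1 + l) * ((1 + l)^-1 * f y + (1 - (1 + l)^-1) * f x) = f y + l * f x.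
  by field; rewrite gt_eqF.
lra.
Qed.

Let epi : set 'rV[R]_(d + 1) := [set u | J (lsubmx u) /\ f (lsubmx u) <= pt u <= M].

Let pt_comb (u u' : 'rV[R]_(d + 1)) (s t : R) : pt (s *: u + t *: u') = s * pt u + t * pt u'.
Proof. by rewrite !ptE !mxE. Qed.

Let lsubmx_comb k (u u' : 'rV[R]_(d + k)) (s t : R) :
  lsubmx (s *: u + t *: u') = s *: lsubmx u + t *: lsubmx u'.
Proof. by apply/rowP => i; rewrite !mxE. Qed.

Let px_comb (w w' : 'rV[R]_(d + 2)) (s t : R) :
  px (s *: w + t *: w') = s *: px w + t *: px w'.
Proof. exact: lsubmx_comb. Qed.

Let conv_le (t x y C : R) : 0 <= t <= 1 -> x <= C -> y <= C -> t * x + (1 - t) * y <= C.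
Proof.
move=> /andP[t0 t1] xC yC.
have : t * x <= t * C by rewrite ler_wpM2l.
have : (1 - t) * y <= (1 - t) * C by rewrite ler_wpM2l // subr_ge0.
lra.
Qed.

Let conv_le2 (t x y x' y' : R) : 0 <= t <= 1 -> x <= x' -> y <= y' ->
  t * x + (1 - t) * y <= t * x' + (1 - t) * y'.
Proof.
by move=> /andP[t0 t1] xx yy; rewrite lerD // ler_wpM2l // subr_ge0.
Qed.

Let epi_cvx : cvx_set epi.
Proof.
move=> u u' t [Ju /andP[fu uM]] [Ju' /andP[fu' u'M]] t01.
split; first by rewrite lsubmx_comb; exact: J_cvx.
rewrite pt_comb conv_le // andbT lsubmx_comb.
apply: (le_trans (f_cvx (J_K Ju) (J_K Ju') t01)).
exact: conv_le2.
Qed.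

Let epi_bounded : exists K, forall u, epi u -> forall j, `|u 0 j| <= K.
Proof.
have [m mf] := f_lower_bound; exists (K0 + `|m| + M).
have K00 : 0 <= K0 by apply: sumr_ge0 => i _; exact: sumr_ge0.
move=> u [Ju /andP[fu uM]]; apply: forall_ord_addn1 => [i|].
  have := J_bounded Ju i; rewrite mxE; have := normr_ge0 m; have := M_ge1; lra.
rewrite -ptE; have := le_trans (mf _ Ju) fu; have := ler_norm (- m).
rewrite normrN ler_norml => mm mu; have := M_ge1 => M1.
have := normr_ge0 m => nm.
apply/andP; split; lra.
Qed.

Let epi_cube : exists c e, 0 < e /\ contains_cube epi c e.
Proof.
have [c [e [e0 cube]]] := simplex_contains_cube v_free.
pose e' := Num.min e 2^-1.
have e'e : e' <= e by rewrite ge_min lexx.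
have e'2 : e' <= 2^-1 by rewrite ge_min lexx orbT.
(* Over [J] one has [f <= mu <= M - 1], so a cube of radius at most 1/2 around height [M - 1/2] fits
   between [f] and [M]. *)
exists (mk2 c (M - 2^-1)), e'; split; first by rewrite lt_min e0 invr_gt0 /=.
move=> u uc.
have Ju : J (lsubmx u).
  apply: cube => i; apply: le_trans e'e.
  by have := uc (lshift 1 i); rewrite mk2E mxE.
split => //.
have := uc (rshift d ord0); rewrite mk2E -ptE ler_norml => /andP[u1 u2].
have := f_le_mu Ju; have := mu_le_M Ju => m1 m2.
apply/andP; split; lra.
Qed.

Let slab : set 'rV[R]_(d + 1) := [set u | J (lsubmx u) /\ 0 <= pt u <= M].

Let slab_measurable : vol_measurable slab.
Proof.
have [c [e [e0 cube]]] := simplex_contains_cube v_free.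
pose e' := Num.min e 2^-1.
have e'e : e' <= e by rewrite ge_min lexx.
have e'2 : e' <= 2^-1 by rewrite ge_min lexx orbT.
have K00 : 0 <= K0 by apply: sumr_ge0 => i _; exact: sumr_ge0.
have M1 := M_ge1.
apply: (@convex_measurable _ _ n1_gt0 _ (const_mx (- (K0 + M))) (const_mx (K0 + M))
  (mk2 c 2^-1) e').
- move=> u u' t [Ju /andP[u0 uM]] [Ju' /andP[u'0 u'M]] t01.
  split; first by rewrite lsubmx_comb; exact: J_cvx.
  rewrite pt_comb conv_le // andbT; have /andP[t0 t1] := t01.
  by rewrite addr_ge0 // mulr_ge0 // subr_ge0.
- move=> u [Ju /andP[u0 uM]]; apply: box_const; apply: forall_ord_addn1 => [i|].
    by have := J_bounded Ju i; rewrite mxE; lra.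
  by rewrite -ptE ger0_norm //; lra.
- by rewrite lt_min e0 invr_gt0 /=.
- move=> u uc; split.
    apply: cube => i; apply: le_trans e'e.
    by have := uc (lshift 1 i); rewrite mk2E mxE.
  have := uc (rshift d ord0); rewrite mk2E -ptE ler_norml => /andP[u1 u2].
  apply/andP; split; lra.
Qed.

Let epi_measurable : vol_measurable epi.
Proof.
have [K EK] := epi_bounded; have [c [e [e0 cube]]] := epi_cube.
apply: (convex_measurable n1_gt0 epi_cvx _ e0 cube) => u Eu.
exact: box_const (EK _ Eu).
Qed.

Let persp_pre : set 'rV[R]_(d + 2) :=
  [set w | [/\ persp_affine a b (px w) (pz w) >= py w,
               py w >= pz w * f ((pz w)^-1 *: px w),
               scale_set (pz w) J (px w) & 0 < pz w <= 1]].

Let persp_affineE w : 0 < pz w ->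
  persp_affine a b (px w) (pz w) = pz w * affine_fun a b ((pz w)^-1 *: px w).
Proof.
move=> z0; rewrite /persp_affine /affine_fun mulrDr [b * _]mulrC; congr (_ + _).
rewrite mulr_sumr; apply: eq_bigr => i _; rewrite [in RHS]mxE.
by field; rewrite gt_eqF.
Qed.

Let scaleJE w : 0 < pz w -> scale_set (pz w) J (px w) <-> J ((pz w)^-1 *: px w).
Proof.
move=> z0; split=> [[x Jx <-]|Jx].
  by rewrite scalerA mulVf ?scale1r // gt_eqF.
by exists ((pz w)^-1 *: px w) => //; rewrite scalerA divff ?scale1r // gt_eqF.
Qed.

Let tower1_epiP w : tower 1 epi w <-> [/\ 0 < pz w <= 1, J ((pz w)^-1 *: px w),
  pz w * f ((pz w)^-1 *: px w) <= py w & py w <= pz w * M].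
Proof.
rewrite /tower /epi /unz /=; have [-> ->] := mk2K ((pz w)^-1 *: px w) (py w / pz w `^ 1).
split=> [[z01 [Jx]]|[z01 Jx fy yM]]; have /andP[z0 z1] := z01.
  by rewrite (powRr1 (ltW z0)) ler_pdivlMr // ler_pdivrMr // ![_ * pz w]mulrC => /andP[].
by rewrite (powRr1 (ltW z0)) ler_pdivlMr // ler_pdivrMr // ![_ * pz w]mulrC fy yM.
Qed.

Let persp_pre_sub : persp_pre `<=` tower 1 epi.
Proof.
move=> w [yp fy sJ z01]; have /andP[z0 z1] := z01.
have Jx := (scaleJE z0).1 sJ.
apply/tower1_epiP; split => //; rewrite persp_affineE // in yp.
apply: (le_trans yp); rewrite ler_pM2l //; have := mu_le_M Jx; lra.
Qed.

Let tower1_epi_body : exists K c e, [/\ tower 1 epi `<=` box (const_mx (- K)) (const_mx K),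
  0 < e & contains_cube (tower 1 epi) c e].
Proof.
have [K EK] := epi_bounded; have [c [e [e0 cube]]] := epi_cube.
have [c' [e' [e'0 cube']]] := tower1_contains_cube e0 cube.
exists (K + 1), c', e'; split => // w tw.
exact: box_const (tower1_bounded EK tw).
Qed.

Let tower1_epi_measurable : vol_measurable (tower 1 epi).
Proof.
have [K [c [e [tK e0 cube]]]] := tower1_epi_body.
exact: (convex_measurable n2_gt0 (cvx_tower1 epi_cvx) tK e0 cube).
Qed.

Let persp_pre_fin : vol persp_pre \is a fin_num.
Proof.
have [K [c [e [tK e0 cube]]]] := tower1_epi_body.
have K_ge0 : 0 <= K.
  have tc : tower 1 epi c by apply: cube => i; rewrite subrr normr0 ltW.
  have := tK _ tc (rshift d ord0); rewrite !mxE => /andP[]; lra.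
rewrite ge0_fin_numE ?vol_ge0 //; apply: le_lt_trans (ltry (boxvol (const_mx (- K)) (const_mx K))).
apply: vol_le_boxvol => //; first by move=> i; rewrite !mxE; lra.
exact: subset_trans tK.
Qed.

(** A closed condition survives the closure. [C] is the sup-norm Lipschitz constant of the ceiling
    plus 1 for the coordinate [y], so accuracy [e / C] gives a total error [e]. *)
Let closure_persp_le w : closure persp_pre w -> py w <= persp_affine a b (px w) (pz w).
Proof.
move=> clw; pose C := \sum_i `|a 0 i| + `|b| + 1.
have C0 : 0 < C by rewrite ltr_wpDl // addr_ge0 // sumr_ge0.
apply/ler_addgt0Pr => e e0.
have eC : 0 < e / C by rewrite divr_gt0.
have [w' [yp _ _ _] ww'] := closure_approx eC clw.
have y1 : py w - py w' <= e / C.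
  by rewrite !pyE; apply: le_trans (ler_norm _) (ltW (ww' _)).
suff : persp_affine a b (px w') (pz w') - persp_affine a b (px w) (pz w)
    <= (\sum_i `|a 0 i| + `|b|) * (e / C).
  have -> : \sum_i `|a 0 i| + `|b| = C - 1 by rewrite addrK.
  rewrite mulrBl mul1r [C * _]mulrC divfK ?gt_eqF //; lra.
rewrite /persp_affine opprD addrACA -sumrB -mulrBr mulrDl; apply: lerD.
  rewrite mulr_suml; apply: ler_sum => i _; rewrite -mulrBr.
  apply: (le_trans (ler_norm _)); rewrite normrM ler_wpM2l // distrC !pxE.
  exact: ltW.
apply: (le_trans (ler_norm _)); rewrite normrM ler_wpM2l // distrC !pzE.
exact: ltW.
Qed.

(** A point of the closure inside [tower 1 epi] lacks only the ceiling condition, which is closed;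
    the other points lie in the null set between that convex tower and its closure. *)
Let vol_Ppersp : vol (Ppersp f J a b) = vol persp_pre.
Proof.
apply/eqP; rewrite eq_le [X in _ && X]le_vol ?andbT; last exact: subset_closure.
have [K [c [e [tK e0 cube]]]] := tower1_epi_body.
have N := vol_closure_setD n2_gt0 (cvx_tower1 epi_cvx) tK e0 cube.
rewrite -[leRHS]adde0 -N; apply: le_trans (volU_le n2_gt0 _ _).
apply: le_vol => w clw; have [tw|ntw] := pselect (tower 1 epi w); [left|right].
  have /tower1_epiP[z01 Jx fy _] := tw; have /andP[z0 z1] := z01.
  split => //; first exact: closure_persp_le.
  exact/scaleJE.
by split => //; apply: closureS clw; exact: persp_pre_sub.
Qed.

Let naive_pos : set 'rV[R]_(d + 2) := [set w | [/\ 0 < pz w <= 1,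
  J ((pz w)^-1 *: px w), f (px w) <= py w & py w <= persp_affine a b (px w) (pz w)]].

(** At [z = 0] only the origin is left: [x] lies in [0 * J], and [y] is squeezed between [f 0 = 0]
    and 0. *)
Let vol_Pnaive : vol (Pnaive f J a b) = vol naive_pos.
Proof.
have Z : vol [set (0 : 'rV[R]_(d + 2))] = 0%E.
  apply/eqP; rewrite eq_le vol_ge0 andbT.
  apply: (le_trans (@vol_le_boxvol _ _ n2_gt0 _ 0 0 _ _)) => //.
    by move=> _ -> i; rewrite lexx.
  by rewrite boxvol_degenerate.
apply/eqP; rewrite eq_le; apply/andP; split; last first.
  apply: le_vol => w [/andP[z0 z1] Jx fy yp]; split => //; first exact/scaleJE.
  by rewrite ltW.
rewrite -[leRHS]adde0 -Z; apply: le_trans (volU_le n2_gt0 _ _).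
apply: le_vol => w [yp fy sJ /andP[z0 z1]].
move: z0; rewrite le_eqVlt => /orP[/eqP z0|z0]; [right|left]; last first.
  by split; rewrite ?z0 //; exact/scaleJE.
have x0 : px w = 0 by case: sJ => x _ <-; rewrite -z0 scale0r.
have y0 : py w = 0.
  apply/eqP; rewrite eq_le; move: yp fy; rewrite x0 -z0 f0 => yp ->; rewrite andbT.
  by move: yp; rewrite /persp_affine mulr0 addr0 big1 // => i _; rewrite mxE mulr0.
apply/rowP; apply: forall_ord_addn2 => [i||].
- by rewrite -pxE x0 !mxE.
- by rewrite -pyE y0 mxE.
- by rewrite -pzE -z0 mxE.
Qed.

Lemma naive_eq_persp : q = 1 -> vol (Pnaive f J a b) = vol (Ppersp f J a b).
Proof.
move=> q1; rewrite vol_Pnaive vol_Ppersp; congr vol; apply/seteqP; split => w.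
  move=> [z01 Jx fy yp]; have /andP[z0 z1] := z01; split => //; last exact/scaleJE.
  by rewrite (fZ _ z0) q1 (powRr1 (ltW z0)) in fy.
move=> [yp fy sJ z01]; have /andP[z0 z1] := z01; split => //; first exact/scaleJE.
by rewrite (fZ _ z0) q1 (powRr1 (ltW z0)).
Qed.

Lemma vol_Ppersp_fin : vol (Ppersp f J a b) \is a fin_num.
Proof. by rewrite vol_Ppersp. Qed.

(** * The case [q > 1] *)

Section StrictlySuperlinear.
Hypothesis q_gt1 : 1 < q.

(** Convexity on the segment from 0 to [x] gives [2^(-q) f x <= f x / 2] at the midpoint, which a
    negative value contradicts because [2^(-q) < 1/2]. *)
Let f_ge0 x : J x -> 0 <= f x.
Proof.
move=> Jx; have h01 : 0 <= (2^-1 : R) <= 1 by apply/andP; split; lra.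
have := f_cvx (J_K Jx) (sub_cvx_hull (or_intror erefl)) h01.
rewrite scaler0 addr0 f0 mulr0 addr0 f_hom; last by case/andP: h01.
have : (2^-1 : R) `^ q < 2^-1.
  rewrite -[ltRHS]powRr1 ?invr_ge0 // /powR invr_eq0 pnatr_eq0 /= ltr_expR ltr_nM2r //.
  by rewrite ln_lt0 //; apply/andP; split; lra.
set h := _ `^ _ => hlt le.
rewrite leNgt; apply/negP => fneg.
by have := ltr_nM2r fneg 2^-1 h; rewrite hlt ltNge le.
Qed.

Let hypo : set 'rV[R]_(d + 1) := [set u | J (lsubmx u) /\ 0 <= pt u < f (lsubmx u)].

(** A region below a convex graph need not be convex; as a difference of two convex bodies it is
    measurable. The strict upper inequality in [hypo] makes this identity exact. *)
Let hypoE : hypo = slab `\` epi.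
Proof.
apply/seteqP; split => u.
  move=> [Ju /andP[u0 uf]]; split.
    split => //; rewrite u0 /=; have := f_le_mu Ju; have := mu_le_M Ju; lra.
  by move=> [_ /andP[]]; rewrite leNgt uf.
move=> [[Ju /andP[u0 uM]] nE]; split => //; rewrite u0 /= ltNge; apply/negP => fu.
by apply: nE; split => //; rewrite fu.
Qed.

Let hypo_measurable : vol_measurable hypo.
Proof. by rewrite hypoE; exact: vol_measurableD. Qed.

Let K00 : 0 <= K0. Proof. by apply: sumr_ge0 => i _; exact: sumr_ge0. Qed.

Let hypo_box : hypo `<=` box (mk2 0 0) (mk2 (const_mx K0) M).
Proof.
rewrite hypoE => u [[Ju uM] _]; apply: forall_ord_addn1 => [i|]; rewrite !mk2E.
  have := J_ge0 Ju i; have := J_bounded Ju i; rewrite !mxE => /ler_normlP[_ -> ->//].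
by rewrite -ptE.
Qed.

Let hypo_tower (p : R) : 1 <= p ->
  vol (tower p hypo) = (((p + d%:R + 1)^-1)%R%:E * vol hypo)%E.
Proof.
move=> p1; apply: (vol_tower p1 _ _ hypo_box hypo_measurable).
  by move=> i; rewrite mxE.
exact: le_trans M_ge1.
Qed.

Let hypo_fin : vol hypo \is a fin_num.
Proof.
rewrite ge0_fin_numE ?vol_ge0 //.
apply: le_lt_trans (ltry (boxvol (mk2 0 0) (mk2 (const_mx K0 : 'rV[R]_d) M))).
apply: vol_le_boxvol => //; apply: forall_ord_addn1 => [i|]; rewrite !mk2E ?mxE //.
exact: le_trans M_ge1.
Qed.

Let towerhypoP (p : R) w : tower p hypo w <-> [/\ 0 < pz w <= 1, J ((pz w)^-1 *: px w),
  0 <= py w & py w < pz w `^ p * f ((pz w)^-1 *: px w)].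
Proof.
rewrite /tower /hypo /unz /=; have [-> ->] := mk2K ((pz w)^-1 *: px w) (py w / pz w `^ p).
split=> [[z01 [Jx]]|[z01 Jx y0 yf]]; have /andP[z0 z1] := z01; have zp := powR_gt0 p z0.
  by rewrite ler_pdivlMr // mul0r ltr_pdivrMr // [_ * _ `^ _]mulrC => /andP[].
by rewrite ler_pdivlMr // mul0r ltr_pdivrMr // [_ * _ `^ _]mulrC y0 yf.
Qed.

Let top : set 'rV[R]_(d + 2) := [set w | [/\ 0 < pz w <= 1,
  J ((pz w)^-1 *: px w), 0 <= py w & py w <= persp_affine a b (px w) (pz w)]].

(** [top] is cut along the measurable [tower 1 epi]. Below the ceiling of [top] this tower coincides
    with [persp_pre], which satisfies [y >= 0] since [f >= 0] on [J]. *)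
Let vol_top_persp : vol top = (vol persp_pre + vol (tower 1 hypo))%E.
Proof.
transitivity (vol (top `&` (tower 1 epi)) + vol (top `&` ~` (tower 1 epi)))%E.
  exact: tower1_epi_measurable.
congr (_ + _)%E; congr vol.
  apply/seteqP; split => w.
    move=> [[z01 Jx y0 yp] /tower1_epiP[_ _ fy _]]; have /andP[z0 z1] := z01.
    by split => //; exact/scaleJE.
  move=> pw; split; last exact: persp_pre_sub.
  have [yp fy sJ z01] := pw; have /andP[z0 z1] := z01.
  have Jx := (scaleJE z0).1 sJ; split => //; apply: le_trans fy.
  by rewrite mulr_ge0 ?f_ge0 // ltW.
apply/seteqP; split => w.
  move=> [[z01 Jx y0 yp] nE]; have /andP[z0 z1] := z01.
  apply/towerhypoP; split => //; rewrite (powRr1 (ltW z0)) ltNge; apply/negP => fy.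
  apply: nE; apply/tower1_epiP; split => //; rewrite persp_affineE // in yp.
  apply: (le_trans yp); rewrite ler_pM2l //; have := mu_le_M Jx; lra.
move=> /towerhypoP[z01 Jx y0]; have /andP[z0 z1] := z01.
rewrite (powRr1 (ltW z0)) => yf; split.
  split => //; rewrite persp_affineE // (le_trans (ltW yf)) // ler_pM2l //.
  exact: f_le_mu.
by move=> /tower1_epiP[_ _]; rewrite leNgt yf.
Qed.

(** The counterpart of [tower 1 epi] for the naive relaxation. The ceiling can be the constant [M]
    because [z mu(x/z) <= M] for [z <= 1]. *)
Let naive_epi : set 'rV[R]_(d + 2) := [set w | [/\ 0 < pz w <= 1,
  J ((pz w)^-1 *: px w), f (px w) <= py w & py w <= M]].

(** Rests on [z^q <= z] and [f >= 0]; it is the reason why the perspective constraint is the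
    stronger one. *)
Let f_scale_le w : 0 < pz w <= 1 -> J ((pz w)^-1 *: px w) ->
  0 <= f (px w) <= pz w * f ((pz w)^-1 *: px w).
Proof.
move=> /andP[z0 z1] Jx; have fx := f_ge0 Jx.
rewrite (fZ _ z0) mulr_ge0 ?powR_ge0 //= ler_wpM2r //.
by apply: ge1r_powR => //; rewrite z0.
Qed.

Let naive_epi_cvx : cvx_set naive_epi.
Proof.
move=> w w' t [z01 Jx fy yM] [z01' Jx' fy' y'M] t01; have /andP[t0 t1] := t01.
have /andP[z0 z1] := z01; have /andP[z0' z1'] := z01'.
(* The cone over [J] is convex because the cone over [epi] is. *)
pose lift_ (w0 : 'rV[R]_(d + 2)) := mk3 (px w0) (pz w0 * M) (pz w0).
have lift_epi w0 : 0 < pz w0 <= 1 -> J ((pz w0)^-1 *: px w0) -> tower 1 epi (lift_ w0).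
  move=> zz JJ; apply/tower1_epiP; rewrite /lift_; have [-> -> ->] := mk3K (px w0) (pz w0 * M) (pz w0).
  split => //; rewrite ler_pM2l; last by case/andP: zz.
  have := f_le_mu JJ; have := mu_le_M JJ; lra.
have := cvx_tower1 epi_cvx (lift_epi _ z01 Jx) (lift_epi _ z01' Jx') t01.
have pyc : py (t *: w + (1 - t) *: w') = t * py w + (1 - t) * py w' by rewrite !pyE !mxE.
move=> /tower1_epiP; rewrite /lift_.
rewrite !px_comb pz_comb.
have [-> _ ->] := mk3K (px w) (pz w * M) (pz w).
have [-> _ ->] := mk3K (px w') (pz w' * M) (pz w').
move=> [zc Jc _ _]; split; rewrite ?pz_comb ?px_comb ?pyc //; last exact: conv_le.
have Kx w0 : 0 < pz w0 <= 1 -> J ((pz w0)^-1 *: px w0) -> cvx_hull (J `|` [set 0]) (px w0).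
  move=> /andP[zz zz1] JJ.
  have -> : px w0 = pz w0 *: ((pz w0)^-1 *: px w0).
    by rewrite scalerA divff ?scale1r // gt_eqF.
  by apply: scaleJ_K => //; rewrite ltW.
apply: (le_trans (f_cvx (Kx _ z01 Jx) (Kx _ z01' Jx') t01)).
exact: conv_le2.
Qed.

Let tower1_epi_naive : tower 1 epi `<=` naive_epi.
Proof.
move=> w /tower1_epiP[z01 Jx fy yM]; have /andP[z0 z1] := z01; split => //.
  by have /andP[_ le] := f_scale_le z01 Jx; exact: le_trans fy.
by rewrite (le_trans yM) // ler_piMl // (le_trans _ M_ge1).
Qed.

Let naive_epi_measurable : vol_measurable naive_epi.
Proof.
have [K [c [e [_ e0 cube]]]] := tower1_epi_body; have M1 := M_ge1; have Kp := K00.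
apply: (@convex_measurable _ _ n2_gt0 _ (const_mx (- (K0 + M))) (const_mx (K0 + M)) c e) => //.
  move=> w [z01 Jx fy yM]; have /andP[z0 z1] := z01.
  apply: box_const; apply: forall_ord_addn2 => [i||].
  - have := J_bounded Jx i; rewrite !mxE normrM gtr0_norm ?invr_gt0 // ler_pdivrMl //.
    by have := ler_wpM2r K00 z1; lra.
  - have /andP[fx _] := f_scale_le z01 Jx.
    by rewrite -pyE ger0_norm ?(le_trans fx) //; lra.
  - by rewrite -pzE gtr0_norm //; lra.
by move=> w /cube; exact: tower1_epi_naive.
Qed.

Let vol_top_naive : vol top = (vol naive_pos + vol (tower q hypo))%E.
Proof.
transitivity (vol (top `&` naive_epi) + vol (top `&` ~` naive_epi))%E.
  exact: naive_epi_measurable.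
congr (_ + _)%E; congr vol.
  apply/seteqP; split => w; first by move=> [[z01 Jx y0 yp] [_ _ fy _]].
  move=> [z01 Jx fy yp]; have /andP[z0 z1] := z01.
  have /andP[fx _] := f_scale_le z01 Jx.
  split; split => //; first exact: le_trans fy.
  rewrite (le_trans yp) // persp_affineE //.
  have := f_le_mu Jx; have := f_ge0 Jx; have := mu_le_M Jx => h1 h2 h3.
  have : 0 <= affine_fun a b ((pz w)^-1 *: px w) by lra.
  by move=> /ler_wpM2r /(_ _ _ z1); lra.
apply/seteqP; split => w.
  move=> [[z01 Jx y0 yp] nE]; have /andP[z0 z1] := z01.
  apply/towerhypoP; split => //; rewrite -fZ // ltNge; apply/negP => fy.
  apply: nE; split => //; rewrite (le_trans yp) // persp_affineE //.
  have := f_le_mu Jx; have := f_ge0 Jx; have := mu_le_M Jx => h1 h2 h3.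
  have : 0 <= affine_fun a b ((pz w)^-1 *: px w) by lra.
  by move=> /ler_wpM2r /(_ _ _ z1); lra.
move=> /towerhypoP[z01 Jx y0]; have /andP[z0 z1] := z01.
rewrite -fZ // => yf; split; last by move=> [_ _]; rewrite leNgt yf.
split => //; rewrite persp_affineE // (le_trans (ltW yf)) //.
have /andP[_ /le_trans] := f_scale_le z01 Jx; apply.
by rewrite ler_pM2l // f_le_mu.
Qed.

(** As [f >= 0] on [J], the negative part lies in the null face [t = 0]. The graph is null too:
    multiplying [t] by [r < 1] maps the closed region into [hypo], except for points with [t = 0],
    which land in that face. *)
Let integral_hypo : integral_over J f = vol hypo.
Proof.
rewrite /integral_over.
set G := [set w | _]; set N := [set w | _ /\ f _ <= _ <= _].
have flat0 : vol (box (mk2 0 0) (mk2 (const_mx K0 : 'rV[R]_d) 0)) = 0%E.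
  rewrite vol_box ?boxvol_mk2 ?subrr ?mulr0 //.
  by apply: forall_ord_addn1 => [i|]; rewrite !mk2E ?mxE.
have flatP (u : 'rV[R]_(d + 1)) : J (lsubmx u) -> pt u = 0 ->
    box (mk2 0 0) (mk2 (const_mx K0 : 'rV[R]_d) 0) u.
  move=> Ju u0; apply: forall_ord_addn1 => [i|]; rewrite !mk2E; last first.
    by rewrite -ptE u0 lexx.
  by have := J_ge0 Ju i; have := J_bounded Ju i; rewrite !mxE => /ler_normlP[_ -> ->].
have -> : vol N = 0%E.
  apply/eqP; rewrite eq_le vol_ge0 andbT -flat0; apply: le_vol => u [Ju /andP[fu u0]].
  apply: flatP => //; apply/eqP; rewrite eq_le u0 /=.
  exact: le_trans (f_ge0 Ju) fu.
rewrite sube0; apply/eqP; rewrite eq_le; apply/andP; split; last first.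
  by apply: le_vol => u [Ju /andP[u0 uf]]; split => //; rewrite u0 ltW.
have shr r : 0 < r < 1 -> (r%:E * vol G <= vol hypo)%E.
  move=> /andP[r0 r1]; pose c : 'rV[R]_(d + 1) := mk2 (const_mx 1) r.
  have c0 : forall j, 0 < c 0 j.
    by apply: forall_ord_addn1 => [i|]; rewrite mk2E ?mxE.
  have -> : r = \prod_j c 0 j.
    rewrite prod_ord_addn1 mk2E big1 ?mul1r // => i _.
    by rewrite mk2E mxE.
  rewrite -(vol_diag_affine G 0 c0).
  rewrite -[leRHS]adde0 -flat0; apply: le_trans (volU_le n1_gt0 _ _).
  apply: le_vol => _ [u [Ju /andP[u0 uf]] <-].
  have lu : lsubmx (diag_affine c 0 u) = lsubmx u.
    by apply/rowP => i; rewrite !mxE mk2E mxE mul1r addr0.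
  have pu : pt (diag_affine c 0 u) = r * pt u.
    by rewrite !ptE !mxE mk2E addr0.
  have u0' : 0 <= pt u by [].
  have uf' : pt u <= f (lsubmx u) by [].
  move: u0'; rewrite le_eqVlt => /orP[/eqP u00|ugt0]; [right|left].
    by apply: flatP; rewrite ?lu // pu -u00 mulr0.
  split; rewrite lu // pu; apply/andP; split; first by rewrite mulr_ge0 // ltW.
  by apply: lt_le_trans uf'; rewrite gtr_pMl.
have Gfin : vol G \is a fin_num.
  rewrite ge0_fin_numE ?vol_ge0 //.
  apply: le_lt_trans (ltry (boxvol (mk2 0 0) (mk2 (const_mx K0 : 'rV[R]_d) M))).
  apply: vol_le_boxvol => //.
    by apply: forall_ord_addn1 => [i|]; rewrite !mk2E ?mxE // (le_trans _ M_ge1).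
  move=> u [Ju /andP[u0 uf]]; apply: forall_ord_addn1 => [i|]; rewrite !mk2E.
    by have := J_ge0 Ju i; have := J_bounded Ju i; rewrite !mxE => /ler_normlP[_ -> ->].
  rewrite -ptE; apply/andP; split => //; have uf' : pt u <= f (lsubmx u) by [].
  have := f_le_mu Ju; have := mu_le_M Ju; lra.
rewrite -(fineK Gfin) -(fineK hypo_fin) lee_fin.
have := @le_at1 R (fun r => r * fine (vol G)) (fun=> fine (vol hypo)).
rewrite mul1r; apply.
- by apply: continuousM; [exact: cvg_id|exact: cst_continuous].
- exact: cst_continuous.
- by move=> r /shr; rewrite -lee_fin EFinM !fineK.
Qed.

Lemma vol_naive_sub_persp :
  (vol (Pnaive f J a b) - vol (Ppersp f J a b))%E =
  (((q - 1) / ((q + d%:R + 1) * (d%:R + 2)))%:E * integral_over J f)%E.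
Proof.
rewrite integral_hypo vol_Pnaive vol_Ppersp.
have := vol_top_naive; rewrite vol_top_persp (hypo_tower q_ge1) (hypo_tower (lexx 1)).
have npfin : vol naive_pos \is a fin_num.
  have : (vol naive_pos <= vol persp_pre + vol (tower 1 hypo))%E.
    rewrite -vol_top_persp; apply: le_vol => w [z01 Jx fy yp]; split => //.
    by have /andP[fx _] := f_scale_le z01 Jx; exact: le_trans fy.
  rewrite ge0_fin_numE ?vol_ge0 // => /le_lt_trans; apply.
  rewrite (hypo_tower (lexx 1)) -(fineK hypo_fin) -(fineK persp_pre_fin) -EFinM -EFinD.
  exact: ltry.
rewrite -(fineK npfin) -(fineK hypo_fin) -(fineK persp_pre_fin).
rewrite -!EFinM -!EFinD => -[e]; congr EFin.
set N := fine (vol naive_pos) in e *; set P := fine (vol persp_pre) in e *.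
set C := fine (vol hypo) in e *.
have q0 := q_gt0; have d0 : 0 <= d%:R :> R by [].
(* The coefficient is the difference of the tower factors for exponents 1 and [q]:
   [1 / (d + 2) - 1 / (q + d + 1)]. *)
have -> : N - P = (1 + d%:R + 1)^-1 * C - (q + d%:R + 1)^-1 * C by lra.
field; apply/andP; split; rewrite gt_eqF //; lra.
Qed.

End StrictlySuperlinear.
End Relaxations.

Unset Implicit Arguments.

Theorem theorem10 (R : realType) (d : nat) (v : 'I_d.+1 -> 'rV[R]_d)
    (q : R) (f : 'rV[R]_d -> R) (a : 'rV[R]_d) (b : R) :
  affinely_independent v ->
  (forall x, cvx_hull (range v) x -> (forall j, 0 <= x 0 j) /\ x != 0) ->
  1 <= q ->
  homogeneous q f ->
  convex_on (cvx_hull (cvx_hull (range v) `|` [set 0])) f ->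
  (forall i, affine_fun a b (v i) = f (v i)) ->
  (vol (Pnaive f (cvx_hull (range v)) a b) - vol (Ppersp f (cvx_hull (range v)) a b))%E =
  (((q - 1) / ((q + d%:R + 1) * (d%:R + 2)))%:E * integral_over (cvx_hull (range v)) f)%E.
Proof.
move=> v_free J_pos q_ge1 f_hom f_cvx mu_v.
have J_ge0 x : cvx_hull (range v) x -> forall j, 0 <= x 0 j by move=> /J_pos[].
move: (q_ge1); rewrite le_eqVlt => /predU1P[q1|q_gt1]; last first.
  exact: vol_naive_sub_persp.
(* For [q = 1] the right side is 0 whatever the integral, since [0 * x = 0] also for infinite [x];
   on the left, equal volumes cancel because they are finite. *)
rewrite -q1 subrr mul0r mul0e (naive_eq_persp v_free J_ge0 q_ge1) //.
by rewrite subee // (vol_Ppersp_fin v_free J_ge0 f_cvx mu_v).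
Qed.
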